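(* Let $\alpha,\beta,\gamma,\lambda>0$ and $u>0$. Let $(U_k)_{k\ge1}$ be i.i.d. positive random variables with $m_\alpha:=\mathbf{E}\,U_1^\alpha<\infty$, let $F$ be the cumulative distribution function of $U_1^\alpha$, let $(V_k)_{k\ge1}$ be i.i.d. random variables with cumulative distribution function $1-e^{-\gamma x^\alpha}$ for $x>0$, and let $N$ be a Poisson arrival process with rate $\lambda$; assume $(U_k)$, $(V_k)$, $N$ are independent. For $n\ge1$ put $X_n=(U_1^\alpha+\dots+U_n^\alpha)^{1/\alpha}$, $Y_n=(V_1^\alpha+\dots+V_n^\alpha)^{1/\alpha}$, and $$\mathcal{R}_t=\Bigl[u^\alpha+\beta^\alpha\sum_{n=1}^\infty Y_n^\alpha\mathbf{1}_{\{N(t)=n\}}\Bigr]^{1/\alpha}-\Bigl[\sum_{n=1}^\infty X_n^\alpha\mathbf{1}_{\{N(t)=n\}}\Bigr]^{1/\alpha},\qquad Q_\infty(u)=\mathbf{P}\{\exists\,t>0:\ \mathcal{R}_t\le 0\}.$$ For $z\ge0$ let $$\delta(z)=\mathbf{P}\Bigl\{\sup_{n\ge1}\sum_{i=1}^n\bigl(U_i^\alpha-\beta^\alpha V_i^\alpha\bigr)<z\Bigr\}.$$ Then the ruin probability for the initial capital $u$ is $Q_\infty(u)=1-\delta(u^\alpha)$, where the function $\delta$ is determined by its Laplace transform $$\widehat{\delta}(s)=\frac{\beta^\alpha-\gamma m_\alpha}{\bigl(\beta^\alpha-\gamma\,\widehat{\overline{F}}(s)\bigr)\,s},\quad s>0,\qquad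 \overline{F}(x):=1-F(x).$$
   Context: For a function $f$ on $[0,\infty)$, $\widehat f(s)=\int_0^\infty e^{-zs}f(z)\,dz$. The Poisson arrival process is $N(t)=\sup\{n\ge1: S_n<t\}$ (equal to $0$ if there is no such $n$), where $S_n=T_1+\dots+T_n$ and $(T_k)$ are i.i.d. exponential with mean $1/\lambda$. Here $u$ is the initial capital of an insurance company, $\mathcal{R}_t$ is the risk process, and $Q_\infty(u)$ is the ruin probability in the infinite time horizon.
   Formalization: The Laplace transform formula and the determination of δ by it are stated under the added condition γ m_α ≤ β^α; when γ m_α > β^α one has δ ≡ 0, so the formula as written is false. The identity Q_∞(u) = 1 − δ(u^α) needs no such condition. *)

(* Defs.v *)
From HB Require Import structures.
From mathcomp Require Import all_boot all_order all_algebra.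
From mathcomp Require Import all_classical all_reals all_analysis.
From mathcomp Require Import measurable_realfun.

Set Implicit Arguments.
Unset Strict Implicit.
Unset Printing Implicit Defensive.

Import Order.TTheory GRing.Theory Num.Theory.
Import numFieldNormedType.Exports.

Local Open Scope classical_set_scope.
Local Open Scope ring_scope.

(* Sequences (U_k), (V_k), (T_k) with k >= 1 are indexed from 0: the k-th random
   variable of the text is [X k.-1], so that X_1 + ... + X_n is
   [\sum_(k < n) X k]. *)

Definition mutually_independent (R : realType) (d : measure_display)
    (Om : measurableType d) (P : probability Om R)
    (X : nat -> {RV P >-> R}) : Prop :=
  forall (J : seq nat) (A : nat -> set R), uniq J ->
    (forall j, measurable (A j)) ->
    P (\big[setI/setT]_(j <- J) (X j @^-1` A j)) =
    (\prod_(j <- J) P (X j @^-1` A j))%E.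

Definition identically_distributed (R : realType) (d : measure_display)
    (Om : measurableType d) (P : probability Om R)
    (X : nat -> {RV P >-> R}) : Prop :=
  forall (k : nat) (A : set R), measurable A ->
    distribution P (X k) A = distribution P (X 0%N) A.

Definition iid (R : realType) (d : measure_display)
    (Om : measurableType d) (P : probability Om R)
    (X : nat -> {RV P >-> R}) : Prop :=
  mutually_independent X /\ identically_distributed X.

Definition sigma_of (I Om : Type) (d' : measure_display)
    (E : measurableType d') (D : set I) (X : I -> Om -> E) : set (set Om) :=
  <<s \bigcup_(i in D) preimage_set_system setT (X i) measurable >>.

(* Since every sigma-algebra contains the whole space, the product rule for
   triples includes the one for pairs. *)
Definition independent3 (R : realType) (d : measure_display)
    (Om : measurableType d) (P : probability Om R)
    (S1 S2 S3 : set (set Om)) : Prop :=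
  forall A B C : set Om, S1 A -> S2 B -> S3 C ->
    P (A `&` B `&` C) = (P A * P B * P C)%E.

(* N(t) = sup {n >= 1 : S_n < t}, and 0 if there is no such n; extended-real
   valued because the set may be unbounded (on a null event only). *)
Definition arrival_count (R : realType) (Om : Type) (T : nat -> Om -> R)
    (t : R) (w : Om) : \bar R :=
  let A := [set n : nat | (1 <= n)%N /\ \sum_(k < n) T k w < t] in
  if `[< A = set0 >] then 0%E else ereal_sup [set (n%:R : R)%:E | n in A].

(* [powR] of a negative base is a junk value, but U_k and V_k are positive
   almost surely. *)
Definition power_sum (R : realType) (Om : Type) (alpha : R)
    (Z : nat -> Om -> R) (n : nat) (w : Om) : R :=
  (\sum_(k < n) Z k w `^ alpha) `^ alpha^-1.

(* The series are real-valued; at most one of their terms is nonzero. *)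
Definition risk_process (R : realType) (Om : Type) (alpha beta u : R)
    (U V : nat -> Om -> R) (N : R -> Om -> \bar R) (t : R) (w : Om) : R :=
  (u `^ alpha + beta `^ alpha *
     \big[+%R/0]_(1 <= n <oo) (power_sum alpha V n w `^ alpha *
                        \1_[set w' | N t w' = (n%:R : R)%:E] w)) `^ alpha^-1
  - (\big[+%R/0]_(1 <= n <oo) (power_sum alpha U n w `^ alpha *
                        \1_[set w' | N t w' = (n%:R : R)%:E] w)) `^ alpha^-1.

Definition ruin_probability (R : realType) (d : measure_display)
    (Om : measurableType d) (P : probability Om R)
    (Rt : R -> Om -> R) : \bar R :=
  P [set w | exists t : R, 0 < t /\ Rt t w <= 0].

(* The supremum is taken in the extended reals: it may be +oo. *)
Definition survival (R : realType) (d : measure_display)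
    (Om : measurableType d) (P : probability Om R) (alpha beta : R)
    (U V : nat -> Om -> R) (z : R) : R :=
  fine (P [set w | (ereal_sup
    [set (\sum_(i < n) (U i w `^ alpha - beta `^ alpha * V i w `^ alpha))%:E
      | n in [set n : nat | (1 <= n)%N]] < z%:E)%E]).

Definition laplace (R : realType) (f : R -> R) (s : R) : R :=
  \int[lebesgue_measure]_(z in `[0, +oo[) (expR (- (z * s)) * f z).

(* The class of functions on [0, +oo[ within which a Laplace transform on
   s > 0 determines the function at every point: without right-continuity
   it would do so only almost everywhere. *)
Definition laplace_class (R : realType) (f : R -> R) : Prop :=
  (forall s : R, 0 < s -> lebesgue_measure.-integrable `[0, +oo[
     (fun z : R => (expR (- (z * s)) * f z)%:E)) /\
  (forall z : R, 0 <= z -> f x @[x --> z^'+] --> f z).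

(* Main.v *)
Require Import Defs.
From HB Require Import structures.
From mathcomp Require Import all_boot all_order all_algebra.
From mathcomp Require Import all_classical all_reals all_analysis.
From mathcomp Require Import measurable_realfun.
From mathcomp Require Import ring lra.

Set Implicit Arguments.
Unset Strict Implicit.
Unset Printing Implicit Defensive.

Import Order.TTheory GRing.Theory Num.Theory.
Import numFieldNormedType.Exports.

Local Open Scope classical_set_scope.
Local Open Scope ring_scope.

(** Write [A_k = U_k^alpha], [B_k = beta^alpha V_k^alpha]; the [B_k] are exponential of
rate [mu = gamma / beta^alpha].  Ruin happens exactly when the walk
[W_n = (A_1 - B_1) + ... + (A_n - B_n)] reaches [u^alpha], since almost surely the
arrival process takes every value.  As [B_1] has no atom and is independent of the
rest, neither has [sup W_n], so it does not matter whether the level is attained.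

For the Laplace transform, let [L_n] be the Lindley recursion
[L_(n+1) = max 0 (A + L_n - B)], whose law is that of [max_(k <= n) W_k].  Integrating
out the exponential [B] gives, for [psi_n s = E exp (- s L_n)] and
[phi s = E exp (- s A)],
[[
  (mu - s) psi_(n+1)(s) = mu phi(s) psi_n(s) - s c_n,   c_n = phi(mu) psi_n(mu).
]]
As [psi_n] decreases to some [psi], the limit satisfies
[psi(s) (s - mu (1 - phi s)) = s c].  Comparing [psi_(n+1) <= psi_n] as [s -> 0] yields
[c >= 1 - mu m], while [psi <= 1] yields [c <= 1 - mu m]; no law of large numbers is
needed, and the critical case [mu m = 1] is included.  Finally
[laplace delta s = psi s / s] and [1 - phi s = s * laplace Fbar s].

Uniqueness: if [exp (- s z) h z] has integral zero for every [s > 0], then so has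
[exp (- z) q (exp (- t z)) h z] for every polynomial [q]; the polynomials
[(1 - x^n)^(2^n)] tend to the indicator of [x < 1/2] on [[0, 1]], so that
[exp (- z) h z] has integral zero on every half-line. *)

(** * Independence and integration over independent pairs *)

Section independence.
Context (R : realType) (d : measure_display) (Om : measurableType d)
  (P : probability Om R).

(** The index type is arbitrary and the variables are bare functions, so that claims and gains can
    be handled together under the index type [bool * nat]. *)
Definition independent_family (I : choiceType) (Z : I -> Om -> R) : Prop :=
  forall (J : seq I) (A : I -> set R), uniq J ->
    (forall j, measurable (A j)) ->
    P (\big[setI/setT]_(j <- J) (Z j @^-1` A j)) =
    (\prod_(j <- J) P (Z j @^-1` A j))%E.

Definition independent2 (X Y : Om -> R) : Prop :=
  forall A B : set R, measurable A -> measurable B ->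
    P (X @^-1` A `&` Y @^-1` B) = (P (X @^-1` A) * P (Y @^-1` B))%E.

(** Both sides are finite measures in [E]. They agree on finite cylinders over [D], which form a
    generating pi-system, hence on the whole sigma-algebra. *)
Lemma independent_sigma_of (I : choiceType) (Z : I -> Om -> R) (j : I)
    (D : set I) (A : set R) (E : set Om) :
  (forall i, measurable_fun setT (Z i)) -> independent_family Z ->
  ~ D j -> measurable A -> sigma_of D Z E ->
  P (Z j @^-1` A `&` E) = (P (Z j @^-1` A) * P E)%E.
Proof.
move=> mZ indZ Dj mA.
have mpre i B : measurable B -> measurable (Z i @^-1` B).
  by move=> mB; rewrite -[X in measurable X]setTI; exact: mZ.
pose cyl (J : seq I) (B : I -> set R) := \big[setI/setT]_(i <- J) (Z i @^-1` B i).
have cylP J B w : cyl J B w <-> (forall i, i \in J -> B i (Z i w)).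
  rewrite /cyl; elim: J => [|i J IH]; first by rewrite big_nil; split.
  rewrite big_cons; split=> [[Bi /IH BJ] k|BJ].
    by rewrite inE => /predU1P[->//|]; exact: BJ.
  split; first by apply: BJ; rewrite mem_head.
  by apply/IH => k kJ; apply: BJ; rewrite inE kJ orbT.
pose G : set (set Om) := [set E | exists J B, [/\ uniq J,
  (forall i, i \in J -> D i), (forall i, measurable (B i)) & E = cyl J B]].
have mA' : measurable (Z j @^-1` A) by exact: mpre.
have Pfin : (0 <= fine (P (Z j @^-1` A)))%R by rewrite fine_ge0.
pose r : {nonneg R} := NngNum Pfin.
pose m1 : {measure set Om -> \bar R} := mrestr P mA'.
pose m2 : {measure set Om -> \bar R} := mscale r P.
have m2E F : m2 F = (P (Z j @^-1` A) * P F)%E.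
  by rewrite -[in RHS](@fineK _ (P (Z j @^-1` A))) ?fin_num_measure.
have GT : G setT.
  exists [::], (fun=> setT); split => //.
  by rewrite /cyl big_nil.
have key : forall F, <<s G >> F -> m1 F = m2 F.
  apply: (g_sigma_algebra_measure_unique G _ (fun=> setT)) => //.
  - move=> _ [J [B [_ _ mB ->]]]; rewrite /cyl.
    by elim/big_rec : _ => // i F _ mF; apply: measurableI => //; exact: mpre.
  - by rewrite bigcup_const.
  (* Two cylinders meet in a cylinder over the merged index list; an index missing from one list is
     given the trivial constraint [setT] there. *)
  - move=> _ _ [J1 [B1 [u1 D1 m1' ->]]] [J2 [B2 [u2 D2 m2' ->]]].
    exists (undup (J1 ++ J2)), (fun i => (if i \in J1 then B1 i else setT) `&`
      (if i \in J2 then B2 i else setT)); split.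
    + exact: undup_uniq.
    + by move=> i; rewrite mem_undup mem_cat => /orP[/D1|/D2].
    + by move=> i; apply: measurableI; case: ifP.
    + apply/seteqP; split=> w.
        move=> [/cylP H1 /cylP H2]; apply/cylP => i _; split; case: ifP => // iJ.
          exact: H1.
        exact: H2.
      move=> /cylP H; split; apply/cylP => i iJ.
        have := H i; rewrite mem_undup mem_cat iJ => /(_ isT)[+ _].
        by rewrite ?iJ.
      have := H i; rewrite mem_undup mem_cat iJ orbT => /(_ isT)[_].
      by rewrite ?iJ.
  - move=> _ [J [B [uJ JD mB ->]]].
    rewrite m2E /m1 /= /mrestr.
    have jJ : j \notin J by apply/negP => /JD.
    (* As [j] is not in [J], one family of sets describes both the cylinder over [J] and its
       intersection with the event on [Z j]. *)
    pose B' i := if i == j then A else B i.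
    have -> : cyl J B `&` Z j @^-1` A = cyl (j :: J) B'.
      rewrite /cyl big_cons /B' eqxx setIC; congr setI.
      rewrite !big_seq; apply: eq_bigr => i iJ.
      by case: eqP => // ij; move: jJ; rewrite -ij iJ.
    have -> : cyl J B = cyl J B'.
      rewrite /cyl !big_seq; apply: eq_bigr => i iJ; rewrite /B'.
      by case: eqP => // ij; move: jJ; rewrite -ij iJ.
    have mB' i : measurable (B' i) by rewrite /B'; case: ifP.
    rewrite /cyl !indZ//=; last by rewrite jJ.
    by rewrite big_cons /B' eqxx.
  - move=> k; rewrite /m1 /= /mrestr setTI.
    exact: (le_lt_trans (probability_le1 _ _) (ltry _)).
move=> sE; have := key E.
rewrite m2E /m1 /= /mrestr setIC; apply.
apply: sub_sigma_algebra2 sE => _ [i Di [B mB <-]].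
exists [:: i], (fun=> B); split => //.
  by move=> k; rewrite inE => /eqP ->.
by rewrite /cyl big_seq1 setTI.
Qed.

(** By independence the joint law agrees with the product of the marginals on rectangles, hence
    everywhere, and Tonelli applies. The second variable is evaluated at a fresh point [v] of the
    same space. *)
Lemma ge0_integral_independent2 (X Y : Om -> R) (g : R * R -> \bar R) :
  measurable_fun setT X -> measurable_fun setT Y -> independent2 X Y ->
  measurable_fun setT g -> (forall p, 0 <= g p)%E ->
  (\int[P]_w g (X w, Y w) = \int[P]_w \int[P]_v g (X w, Y v))%E.
Proof.
move=> mX mY indXY mg g0.
pose X' : {RV P >-> R} := mfun_Sub (mem_set mX).
pose Y' : {RV P >-> R} := mfun_Sub (mem_set mY).
have mXY : measurable_fun setT (fun w => (X w, Y w)) by exact: measurable_fun_pair.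
pose XY' : {mfun Om >-> (R * R)%type} := mfun_Sub (mem_set mXY).
transitivity (\int[distribution P XY']_p g p)%E.
  by rewrite ge0_integral_distribution.
transitivity (\int[distribution P X' \x distribution P Y']_p g p)%E.
  apply/esym/eq_measure_integral => C mC _.
  by apply: product_measure_unique.
rewrite fubini_tonelli1//= /fubini_F ge0_integral_distribution//=.
- apply: eq_integral => w _; rewrite ge0_integral_distribution//=.
  by apply: measurableT_comp => //; exact: measurable_fun_pair.
- exact: (measurable_fun_fubini_tonelli_F (m2 := distribution P Y')).
- by move=> x; apply: integral_ge0.
Qed.

End independence.

(** * Laplace transforms of random variables *)

Section exponential_integrals.
Context (R : realType).
Implicit Types (c h s y : R).

Lemma continuous_expRM c : continuous (fun t : R => expR (c * t)).
Proof.
move=> t; apply: (@continuous_comp _ _ _ (fun x => c * x) expR).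
  exact: mulrl_continuous.
exact: continuous_expR.
Qed.

Lemma measurable_expRM c : measurable_fun setT (fun t : R => expR (c * t)).
Proof. by apply: continuous_measurable_fun; exact: continuous_expRM. Qed.

Lemma is_derive_expRM c (t : R) :
  is_derive t 1 (fun x : R => expR (c * x)) (c * expR (c * t)).
Proof.
have d1 : is_derive t (1 : R) (c \*: (@id R)) (c *: (1 : R)).
  exact: (is_deriveZ c (is_derive_id t 1)).
rewrite mulrC -[X in _ * X]mulr1.
exact: (is_derive1_comp (is_derive_expR (c * t)) d1).
Qed.

Lemma is_derive_expRM_div c (t : R) : c != 0 ->
  is_derive t 1 (fun x : R => c^-1 * expR (c * x)) (expR (c * t)).
Proof.
move=> c0; have := is_derive_expRM c t => dE.
have : is_derive t 1 (c^-1 \*: (fun x : R => expR (c * x))) (c^-1 *: (c * expR (c * t))).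
  exact: is_deriveZ.
by rewrite /GRing.scale/= mulKf.
Qed.

Lemma integral_expRM_itv c h : c != 0 -> 0 <= h ->
  (\int[lebesgue_measure]_(t in `[0%R, h]) (expR (c * t))%:E
   = ((expR (c * h) - 1) / c)%:E)%E.
Proof.
move=> c0; rewrite le_eqVlt => /predU1P[<-|h0].
  by rewrite set_itv1 integral_set1 mulr0 expR0 subrr mul0r.
pose G x := c^-1 * expR (c * x).
have dG x : derivable G x 1.
  by case: (@is_derive_expRM_div c x c0).
have cG : continuous G.
  by move=> x; apply/differentiable_continuous; rewrite -derivable1_diffP.
rewrite (@continuous_FTC2 _ (fun x => expR (c * x)) G)//.
- by rewrite /G mulr0 expR0 -EFinB -mulrBr mulrC.
- by apply: continuous_subspaceT => x; exact: continuous_expRM.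
- split => //; first exact/cvg_at_right_filter/cG.
  exact/cvg_at_left_filter/cG.
- move=> x _; rewrite derive1E; case: (@is_derive_expRM_div c x c0) => _ <-.
  by [].
Qed.

Lemma integral_expRM_itvy s y : 0 < s ->
  (\int[lebesgue_measure]_(z in `[y, +oo[) (expR (- (z * s)))%:E
   = (expR (- (s * y)) / s)%:E)%E.
Proof.
move=> s0; have c0 : - s != 0 by rewrite oppr_eq0 gt_eqF.
pose G x := (- s)^-1 * expR (- s * x).
have dG x : derivable G x 1.
  by case: (@is_derive_expRM_div (- s) x c0).
have cG : continuous G.
  by move=> x; apply/differentiable_continuous; rewrite -derivable1_diffP.
under eq_integral do rewrite mulrC -mulNr.
rewrite (@ge0_continuous_FTC2y _ (fun x => expR (- s * x)) G y 0)//.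
- by rewrite sub0e -EFinN /G invrN mulNr opprK mulrC mulNr.
- by apply: continuous_subspaceT => x; exact: continuous_expRM.
- rewrite -[X in _ --> X](mulr0 (- s)^-1); apply: cvgMr.
  rewrite (_ : (fun x => expR (- s * x)) =
               (fun z => expR (- z)) \o (fun z => s * z)); last first.
    by apply: eq_fun => x; rewrite mulNr.
  apply: (@cvg_comp _ _ _ _ _ _ (pinfty_nbhs R)); last exact: cvgr_expR.
  exact: gt0_cvgMry.
- exact/cvg_at_right_filter/cG.
- move=> x _; rewrite derive1E; case: (@is_derive_expRM_div (- s) x c0) => _ <-.
  by [].
Qed.

End exponential_integrals.

Lemma measurable_expRN (R : realType) (d : measure_display) (T : measurableType d)
    (Y : T -> R) (s : R) : measurable_fun setT Y ->
  measurable_fun setT (fun w => expR (- (s * Y w))).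
Proof.
by move=> mY; apply: measurableT_comp => //; apply: measurableT_comp => //;
  exact: measurable_funM.
Qed.

Lemma integrable_expRN_itvy (R : realType) (s : R) : 0 < s ->
  lebesgue_measure.-integrable `[0, +oo[ (fun z : R => (expR (- (z * s)))%:E).
Proof.
move=> s0; apply/integrableP; split.
  apply/measurable_EFinP; apply: measurable_funTS.
  under eq_fun do rewrite mulrC.
  exact: measurable_expRN.
under eq_integral do rewrite /= ger0_norm ?expR_ge0//.
by rewrite integral_expRM_itvy// ltry.
Qed.

(** Monotonicity supplies measurability; the bounds on [f] supply domination by the exponential.
    Distribution functions satisfy both. *)
Lemma integrable_expRN_mul (R : realType) (s : R) (f : R -> R) : 0 < s ->
  {homo f : x y / x <= y} -> (forall z, 0 <= f z <= 1) ->
  lebesgue_measure.-integrable `[0, +oo[ (fun z : R => (expR (- (z * s)) * f z)%:E).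
Proof.
move=> s0 fnd f01; have i_s := integrable_expRN_itvy s0.
apply: le_integrable (i_s) => //.
  apply/measurable_EFinP; apply: measurable_funM.
    by apply/measurable_EFinP; exact: (measurable_int lebesgue_measure i_s).
  exact: nondecreasing_measurable.
move=> z _; have /andP[f0 f1] := f01 z; rewrite lee_fin normrM ler_piMr//.
by rewrite ger0_norm.
Qed.

Section laplace_stieltjes.
Context (R : realType) (d : measure_display) (Om : measurableType d)
  (P : probability Om R).
Implicit Types (X Y B H : Om -> R) (s t : R).

(** The Laplace-Stieltjes transform of the law of [Y]. *)
Definition lst Y s : R := \int[P]_w expR (- (s * Y w)).

Lemma expRN_le1 s (y : R) : 0 <= s -> 0 <= y -> expR (- (s * y)) <= 1.
Proof. by move=> s0 y0; rewrite -expR0 ler_expR oppr_le0 mulr_ge0. Qed.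

Lemma integrable_le1 (f : Om -> R) : measurable_fun setT f ->
  (forall w, 0 <= f w <= 1) -> P.-integrable setT (EFin \o f).
Proof.
move=> mf f01; apply: (@le_integrable _ _ _ P setT measurableT _ (EFin \o cst 1)).
- exact/measurable_EFinP.
- move=> w _ /=; have /andP[f0 f1] := f01 w.
  by rewrite lee_fin normr1 ger0_norm.
- exact: finite_measure_integrable_cst.
Qed.

Lemma integrable_expRN Y s : measurable_fun setT Y -> (forall w, 0 <= Y w) ->
  0 <= s -> P.-integrable setT (EFin \o (fun w => expR (- (s * Y w)))).
Proof.
move=> mY Y0 s0; apply: integrable_le1; first exact: measurable_expRN.
by move=> w; rewrite expR_ge0 expRN_le1.
Qed.

Lemma lstE Y s : measurable_fun setT Y -> (forall w, 0 <= Y w) -> 0 <= s ->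
  (\int[P]_w (expR (- (s * Y w)))%:E = (lst Y s)%:E)%E.
Proof.
move=> mY Y0 s0; rewrite /lst /Rintegral fineK//.
by apply: integrable_fin_num => //; exact: integrable_expRN.
Qed.

Lemma lst_ge0 Y s : 0 <= lst Y s.
Proof. by apply: Rintegral_ge0 => w _; exact: expR_ge0. Qed.

Lemma le_lst X Y s : measurable_fun setT X -> measurable_fun setT Y ->
  (forall w, 0 <= X w) -> (forall w, X w <= Y w) -> 0 <= s ->
  lst Y s <= lst X s.
Proof.
move=> mX mY X0 XY s0; apply: le_Rintegral => //.
- apply: integrable_expRN => // w; exact: le_trans (XY w).
- exact: integrable_expRN.
- by move=> w _; rewrite ler_expR lerN2 ler_wpM2l.
Qed.

Lemma lst_le1 Y s : measurable_fun setT Y -> (forall w, 0 <= Y w) -> 0 <= s ->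
  lst Y s <= 1.
Proof.
move=> mY Y0 s0; rewrite -lee_fin -lstE//.
have -> : (1%:E = \int[P]_w (1%:E : \bar R))%E.
  by rewrite integral_cst//= probability_setT mule1.
apply: ge0_le_integral => //.
- by apply/measurable_EFinP; exact: measurable_expRN.
- by move=> w _; rewrite lee_fin expRN_le1.
Qed.

Lemma lst_cvg1 Y : measurable_fun setT Y -> (forall w, 0 <= Y w) ->
  lst Y n.+1%:R^-1 @[n --> \oo] --> (1 : R).
Proof.
move=> mY Y0; apply: fine_cvg.
have -> : (1%:E = \int[P]_w (1%:E : \bar R))%E.
  by rewrite integral_cst//= probability_setT mule1.
have [] := @dominated_convergence _ _ _ P setT measurableT
  (fun n w => (expR (- (n.+1%:R^-1 * Y w)))%:E) (fun=> 1%:E) (fun=> 1%:E) => //.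
- by move=> n; apply/measurable_EFinP; exact: measurable_expRN.
- apply: aeW => w _; apply: cvg_EFin; first exact: nearW.
  rewrite -[X in _ --> X]expR0; apply: continuous_cvg; first exact: continuous_expR.
  rewrite -[X in _ --> X]oppr0; apply: cvgN.
  rewrite -[X in _ --> X](mul0r (Y w)); apply: cvgMl.
  exact: cvg_harmonic.
- exact: finite_measure_integrable_cst.
- by apply: aeW => w n _; rewrite gee0_abs ?lee_fin ?expR_ge0// expRN_le1.
Qed.

Lemma lst_add X Y s : measurable_fun setT X -> measurable_fun setT Y ->
  (forall w, 0 <= X w) -> (forall w, 0 <= Y w) -> independent2 P X Y -> 0 <= s ->
  lst (fun w => X w + Y w) s = lst X s * lst Y s.
Proof.
move=> mX mY X0 Y0 indXY s0; apply: EFin_inj.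
rewrite -lstE//; [|exact: measurable_funD|by move=> w; rewrite addr_ge0].
have mg : measurable_fun setT (fun p : R * R => (expR (- (s * (p.1 + p.2))))%:E).
  apply/measurable_EFinP; apply: measurable_expRN.
  exact: measurable_funD.
rewrite (ge0_integral_independent2
  (g := fun p => (expR (- (s * (p.1 + p.2))))%:E) mX mY indXY)//=.
under eq_integral => w _.
  under eq_integral do rewrite mulrDr opprD expRD EFinM.
  rewrite ge0_integralZl//; last by apply/measurable_EFinP; exact: measurable_expRN.
  rewrite lstE//.
  over.
rewrite ge0_integralZr//.
- by rewrite lstE.
- by apply/measurable_EFinP; exact: measurable_expRN.
- by rewrite lee_fin lst_ge0.
Qed.

Lemma measurable_preimage_itv Y (i : interval R) : measurable_fun setT Y ->
  measurable (Y @^-1` [set` i]).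
Proof. by move=> mY; rewrite -[X in measurable X]setTI; exact: mY. Qed.

(** Tonelli for [g] times the indicator of [S]. With [S] given by [t < B w] or by [Y w <= z] it
    exchanges exponential moments with integrals of tails or distribution functions. *)
Lemma fubini_sections (S : set (Om * R)) (g : R -> R) :
  measurable S -> measurable_fun setT g -> (forall t, 0 <= g t) ->
  (\int[P]_w \int[lebesgue_measure]_(t in [set t | S (w, t)]) (g t)%:E =
   \int[lebesgue_measure]_t ((g t)%:E * P [set w | S (w, t)]))%E.
Proof.
move=> mS mg g0.
pose f (p : Om * R) := ((g p.2)%:E * (\1_S p)%:E)%E.
have mf : measurable_fun setT f.
  apply: emeasurable_funM; apply/measurable_EFinP.
    exact: measurableT_comp.
  exact: measurable_indic.
have f0 p : (0 <= f p)%E by rewrite mule_ge0 ?lee_fin.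
transitivity (\int[P]_w \int[lebesgue_measure]_t f (w, t))%E.
  apply: eq_integral => w _; rewrite integral_mkcond; apply: eq_integral => t _.
  rewrite patchE /f/= indicE.
  have -> : (t \in [set t0 | S (w, t0)]) = ((w, t) \in S).
    by apply/idP/idP; rewrite !inE.
  by case: ifP => _; rewrite ?mule1 ?mule0.
rewrite (@fubini_tonelli _ _ _ _ _ P (@lebesgue_measure R) f)//; apply: eq_integral => t _.
have mSt : measurable [set w | S (w, t)].
  rewrite (_ : [set w | S (w, t)] = ysection S t); first exact: measurable_ysection.
  by apply/seteqP; split=> w; rewrite /ysection/= inE.
have indS w : \1_S (w, t) = \1_[set w | S (w, t)] w :> R.
  by rewrite !indicE; congr (nat_of_bool _)%:R; apply/idP/idP; rewrite !inE.
rewrite /f/=; under eq_integral do rewrite indS.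
rewrite ge0_integralZl ?lee_fin//.
  by rewrite integral_indic// setIT.
by apply/measurable_EFinP; exact: measurable_indic.
Qed.

(** Since [h - max 0 (h - B) = min B h], the integrand is [exp (- s h) * exp (s * min B h)], and the
    expectation of the second factor is computed from the tail of [B]. *)
Lemma lst_overshoot_cst B mu s h : measurable_fun setT B -> (forall w, 0 <= B w) ->
  (forall t, 0 <= t -> P [set w | t < B w] = (expR (- (mu * t)))%:E) ->
  0 < s -> s != mu -> 0 <= h ->
  (\int[P]_w (expR (- (s * Num.max 0 (h - B w))))%:E =
   ((mu * expR (- (s * h)) - s * expR (- (mu * h))) / (mu - s))%:E)%E.
Proof.
move=> mB B0 PB s0 smu h0.
have sn0 : s != 0 by rewrite gt_eqF.
have c0 : s - mu != 0 by rewrite subr_eq0.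
pose S := [set p : Om * R | p.2 < B p.1 /\ p.2 \in `[0, h]].
have mS : measurable S.
  apply: measurableI.
    rewrite -[X in measurable X]setTI.
    have : measurable_fun setT (fun p : Om * R => p.2 < B p.1).
      by apply: measurable_fun_ltr => //; exact: measurableT_comp.
    by move=> /(_ measurableT [set true]); exact.
  rewrite -[X in measurable X]setTI.
  have m2 : measurable_fun setT (@snd Om R) by [].
  exact: (m2 measurableT _ (measurable_itv `[0, h])).
have mes : measurable_fun setT (fun t => expR (s * t)) := measurable_expRM s.
have step w : (\int[lebesgue_measure]_(t in [set t | S (w, t)]) (expR (s * t))%:E =
    (* The section is [[0, B w[] or [[0, h]] according to which bound is smaller; the missing
       endpoint has measure zero. *)
    ((expR (s * Num.min (B w) h) - 1) / s)%:E)%E.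
  have [Bh|hB] := leP (B w) h.
    have -> : [set t | S (w, t)] = `[0, B w[%classic.
      apply/seteqP; split=> t /=; rewrite /S/= !in_itv/=.
        by move=> [-> /andP[->]].
      by move=> /andP[-> tB]; rewrite tB (le_trans (ltW tB)).
    rewrite integral_itv_bndo_bndc; last first.
      by apply/measurable_EFinP; exact: measurable_funTS.
    by rewrite integral_expRM_itv.
  have -> : [set t | S (w, t)] = `[0, h]%classic.
    apply/seteqP; split=> t /=; rewrite /S/= !in_itv/=; first by case.
    by move=> /andP[-> th]; rewrite th (le_lt_trans th).
  by rewrite integral_expRM_itv.
have G := fubini_sections mS mes (fun t => expR_ge0 _).
(* [exp (s min(B, h)) - 1] is the integral of [s exp (s t)] over [t < B, t <= h]. *)
have G2 : (\int[P]_w ((expR (s * Num.min (B w) h) - 1) / s)%:E =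
           ((expR ((s - mu) * h) - 1) / (s - mu))%:E)%E.
  rewrite -(integral_expRM_itv c0 h0) [RHS]integral_mkcond.
  transitivity (\int[P]_w \int[lebesgue_measure]_(t in [set t | S (w, t)])
      (expR (s * t))%:E)%E; first by apply: eq_integral => w _; rewrite step.
  rewrite G; apply: eq_integral => t _.
  rewrite patchE; case: ifPn => [|]; rewrite ?inE ?notin_setE/= => tI.
    rewrite (_ : [set w | S (w, t)] = [set w | t < B w]).
      move: tI; rewrite in_itv/= => /andP[t0 _].
      by rewrite PB// -EFinM -expRD; congr (expR _)%:E; ring.
    by apply/seteqP; split=> w /=; rewrite /S/= ?tI //; case.
  rewrite (_ : [set w | S (w, t)] = set0) ?measure0 ?mule0//.
  by rewrite -subset0 => w [_ /=].
pose q w := (expR (s * Num.min (B w) h) - 1) / s.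
have q0 w : 0 <= q w.
  rewrite divr_ge0 ?(ltW s0)// subr_ge0 -expR0 ler_expR mulr_ge0 ?(ltW s0)//.
  by rewrite le_min B0 h0.
have mq : measurable_fun setT q.
  apply: measurable_funM => //; apply: measurable_funB => //.
  apply: (measurableT_comp (measurable_expRM s)).
  by apply: measurable_minr.
have qE w : (expR (- (s * Num.max 0 (h - B w))))%:E =
    ((expR (- (s * h)))%:E * (1 + s%:E * (q w)%:E))%E.
  transitivity (expR (- (s * h)) * (1 + s * q w))%:E; last first.
    by rewrite EFinM EFinD EFinM.
  rewrite /q [s * (_ / _)]mulrC divfK// [1 + _]addrC subrK -expRD.
  congr (expR _)%:E; case: (leP (B w) h) => Bh.
    by rewrite max_r ?subr_ge0//; ring.
  by rewrite max_l ?subr_le0 ?(ltW Bh)//; ring.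
under eq_integral do rewrite qE.
rewrite ge0_integralZl ?lee_fin ?expR_ge0//; last 2 first.
- apply: emeasurable_funD => //; apply: emeasurable_funM => //.
  exact/measurable_EFinP.
- by move=> w _; rewrite adde_ge0// mule_ge0 ?lee_fin ?(ltW s0).
rewrite ge0_integralD//=; last 2 first.
- by move=> w _; rewrite mule_ge0 ?lee_fin ?(ltW s0).
- by apply: emeasurable_funM => //; exact/measurable_EFinP.
rewrite integral_cst//= probability_setT mule1.
rewrite ge0_integralZl ?lee_fin ?(ltW s0)//; last 2 first.
- exact/measurable_EFinP.
- by move=> w _; rewrite lee_fin.
rewrite G2; transitivity (expR (- (s * h)) *
    (1 + s * ((expR ((s - mu) * h) - 1) / (s - mu))))%:E.
  by rewrite EFinM EFinD EFinM.
congr (_%:E).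
(* Once both sides use the same two exponentials, the identity is one of rational functions. *)
have -> : expR (- (mu * h)) = expR (- (s * h)) * expR ((s - mu) * h).
  by rewrite -expRD; congr expR; ring.
by field; rewrite c0 subr_eq0 eq_sym smu.
Qed.

(** By independence [H] can be frozen while [B] is integrated out, and the previous formula is
    linear in [exp (- s H)] and [exp (- mu H)]. *)
Lemma lst_overshoot B H mu s : measurable_fun setT B -> measurable_fun setT H ->
  (forall w, 0 <= B w) -> (forall w, 0 <= H w) -> independent2 P H B ->
  (forall t, 0 <= t -> P [set w | t < B w] = (expR (- (mu * t)))%:E) ->
  0 < s -> 0 < mu -> s != mu ->
  (mu - s) * lst (fun w => Num.max 0 (H w - B w)) s =
  mu * lst H s - s * lst H mu.
Proof.
move=> mB mH B0 H0 indHB PB s0 mu0 smu.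
have c0 : mu - s != 0 by rewrite subr_eq0 eq_sym.
pose g (p : R * R) := (expR (- (s * Num.max 0 (p.1 - p.2))))%:E.
have mg : measurable_fun setT g.
  apply/measurable_EFinP; apply: measurable_expRN; apply: measurable_maxr => //.
  exact: measurable_funB.
rewrite [X in _ * X](_ : _ = (mu * lst H s - s * lst H mu) / (mu - s)); last first.
  apply: EFin_inj; rewrite -lstE ?(ltW s0)//; last 2 first.
  - by apply: measurable_maxr => //; exact: measurable_funB.
  - by move=> w; rewrite le_max lexx.
  transitivity (\int[P]_w g (H w, B w))%E; first by [].
  rewrite ge0_integral_independent2//; last by move=> p; rewrite lee_fin expR_ge0.
  under eq_integral => w _ do rewrite (lst_overshoot_cst mB B0 PB s0 smu (H0 w)).
  have iE t : 0 < t -> P.-integrable setT (EFin \o (fun w => expR (- (t * H w)))).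
    by move=> t0; apply: integrable_expRN => //; exact: ltW.
  have iZ a t : 0 < t -> P.-integrable setT (EFin \o (fun w => a * expR (- (t * H w)))).
    by move=> t0; exact: (integrableZl measurableT a (iE t t0)).
  have iB := integrableB measurableT (iZ mu s s0) (iZ s mu mu0).
  transitivity (\int[P]_w
      ((mu * expR (- (s * H w)) - s * expR (- (mu * H w))) / (mu - s)))%:E.
    rewrite fineK//.
    exact: (integrable_fin_num measurableT (integrableZr measurableT (mu - s)^-1 iB)).
  congr EFin; rewrite RintegralZr//.
  rewrite RintegralB//; [|exact: iZ|exact: iZ].
  by rewrite !RintegralZl//; exact: iE.
by rewrite mulrC divfK.
Qed.

(** By Tonelli on [Y w <= z], the inner integral runs over [[Y w, +oo[] and equals
    [exp (- s Y) / s]. *)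
Lemma integral_expRN_cdf Y s : measurable_fun setT Y -> (forall w, 0 <= Y w) ->
  0 < s ->
  (\int[lebesgue_measure]_(z in `[0%R, +oo[)
     ((expR (- (z * s)))%:E * P [set w | (Y w <= z)%R]) = (lst Y s / s)%:E)%E.
Proof.
move=> mY Y0 s0.
pose S := [set p : Om * R | Y p.1 <= p.2].
have mS : measurable S.
  rewrite -[X in measurable X]setTI.
  have : measurable_fun setT (fun p : Om * R => Y p.1 <= p.2).
    by apply: measurable_fun_ler => //; exact: measurableT_comp.
  by move=> /(_ measurableT [set true]); exact.
have mg : measurable_fun setT (fun z : R => expR (- (z * s))).
  rewrite (_ : (fun _ => _) = (fun z => expR (- s * z))); last first.
    by apply/funext => z; rewrite mulrC mulNr.
  exact: measurable_expRM.
have := fubini_sections mS mg (fun z => expR_ge0 _).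
have -> : (\int[P]_w \int[lebesgue_measure]_(t in [set t | S (w, t)])
    (expR (- (t * s)))%:E = (lst Y s / s)%:E)%E.
  under eq_integral => w _.
    rewrite (_ : [set t | S (w, t)] = `[Y w, +oo[%classic); last first.
      by apply/seteqP; split=> t/=; rewrite in_itv/= andbT.
    rewrite integral_expRM_itvy// EFinM.
    over.
  rewrite ge0_integralZr//.
  - by rewrite lstE ?ltW.
  - by apply/measurable_EFinP; exact: measurable_expRN.
  - by rewrite lee_fin invr_ge0 ltW.
move=> ->; rewrite integral_mkcond; apply: eq_integral => z _; rewrite patchE.
case: ifPn => //; rewrite notin_setE/= in_itv/= andbT => /negP; rewrite -ltNge => z0.
rewrite (_ : [set w | _] = set0) ?measure0 ?mule0//.
by rewrite -subset0 => w /= Yz; have := Y0 w; rewrite leNgt (le_lt_trans Yz).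
Qed.

Lemma laplace_ccdf Y (F : R -> R) s : measurable_fun setT Y -> (forall w, 0 <= Y w) ->
  (forall x, P [set w | Y w <= x] = (F x)%:E) -> 0 < s ->
  laplace (fun x => 1 - F x) s = (1 - lst Y s) / s.
Proof.
move=> mY Y0 hF s0.
have mset x : measurable [set w | Y w <= x].
  rewrite (_ : [set w | _] = Y @^-1` `]-oo, x]); first exact: measurable_preimage_itv.
  by apply/seteqP; split=> w /=; rewrite in_itv.
have F01 x : 0 <= F x <= 1.
  by rewrite -!lee_fin -hF measure_ge0 probability_le1.
have Fnd : {homo F : x y / x <= y}.
  move=> x y xy; rewrite -lee_fin -!hF le_measure ?inE// => w /= /le_trans; exact.
have iF := integrable_expRN_mul s0 Fnd F01.
rewrite /laplace; under eq_Rintegral do rewrite mulrBr mulr1.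
rewrite RintegralB//; last exact: integrable_expRN_itvy.
rewrite mulrBl; congr (_ - _).
  by rewrite /Rintegral integral_expRM_itvy//= mulr0 oppr0 expR0.
rewrite /Rintegral; apply: EFin_inj; rewrite fineK.
  rewrite -integral_expRN_cdf//; apply: eq_integral => z _.
  by rewrite hF.
have mD : measurable (`[0%R, +oo[%classic : set (measurableTypeR R)).
  exact: measurable_itv.
exact: (integrable_fin_num mD iF).
Qed.

End laplace_stieltjes.

(** * Uniqueness of Laplace transforms *)

Section lerch.
Context (R : realType).
Implicit Types (h : R -> R) (a b r s x z : R).

Lemma bernoulli_ge (y : R) (N : nat) : 0 <= y <= 1 -> 1 - N%:R * y <= (1 - y) ^+ N.
Proof.
move=> /andP[y0 y1]; elim: N => [|N IH]; first by rewrite mul0r subr0 expr0.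
rewrite exprS; apply: le_trans (_ : (1 - y) * (1 - N%:R * y) <= _); last first.
  by rewrite ler_wpM2l// subr_ge0.
rewrite -subr_ge0 (_ : _ - _ = N%:R * y ^+ 2); last by rewrite -natr1; ring.
by rewrite mulr_ge0// exprn_ge0.
Qed.

Lemma bernoulli_le (y : R) (N : nat) : 0 <= y <= 1 -> N%:R * y * (1 - y) ^+ N <= 1.
Proof.
move=> /andP[y0 y1].
(* The strengthened bound is the one that passes through the induction. *)
suff : (1 + N%:R * y) * (1 - y) ^+ N <= 1.
  by apply: le_trans; rewrite ler_wpM2r ?exprn_ge0 ?subr_ge0// lerDr.
elim: N => [|N IH]; first by rewrite mul0r addr0 expr0 mulr1.
apply: le_trans IH; rewrite exprS mulrA ler_wpM2r ?exprn_ge0 ?subr_ge0//.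
rewrite -subr_ge0 (_ : _ - _ = N.+1%:R * y ^+ 2); last by rewrite -natr1; ring.
by rewrite mulr_ge0// exprn_ge0.
Qed.

(** Taking [y = x^n] and [N = 2^n] gives [N y = (2 x)^n], so Bernoulli's inequality bounds the power
    below by [1 - (2 x)^n], which tends to 1. *)
Lemma cvg_step_lt x : 0 <= x -> x < 2^-1 ->
  (1 - x ^+ n.+1) ^+ (2 ^ n.+1) @[n --> \oo] --> (1 : R).
Proof.
move=> x0 x2.
have x1 : x <= 1 by lra.
have c : 1 - (2 * x) ^+ n.+1 @[n --> \oo] --> (1 : R).
  rewrite -[X in _ --> X]subr0; apply: cvgB; first exact: cvg_cst.
  rewrite (cvg_shiftS (fun n => (2 * x) ^+ n)).
  by apply: cvg_expr; rewrite ger0_norm; lra.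
apply: (squeeze_cvgr (h := fun=> 1) _ c); last exact: cvg_cst.
apply: nearW => n.
have y01 : 0 <= x ^+ n.+1 <= 1 by rewrite exprn_ge0// exprn_ile1.
apply/andP; split; last first.
  by case/andP: y01 => y0 y1; rewrite exprn_ile1 ?subr_ge0// gerBl.
by apply: le_trans (bernoulli_ge _ y01); rewrite exprMn natrX.
Qed.

(** With the same choice of [y] and [N], [bernoulli_le] bounds the power above by [(2 x)^(-n)],
    which tends to 0. *)
Lemma cvg_step_gt x : 2^-1 < x -> x <= 1 ->
  (1 - x ^+ n.+1) ^+ (2 ^ n.+1) @[n --> \oo] --> (0 : R).
Proof.
move=> x2 x1; have x0 : 0 < x by lra.
have c : (2 * x)^-1 ^+ n.+1 @[n --> \oo] --> (0 : R).
  rewrite (cvg_shiftS (fun n => (2 * x)^-1 ^+ n)).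
  apply: cvg_expr; rewrite ger0_norm ?invr_ge0; last lra.
  by rewrite invf_lt1; lra.
apply: (squeeze_cvgr (f := fun=> 0) _ _ c); last exact: cvg_cst.
apply: nearW => n.
have y01 : 0 <= x ^+ n.+1 <= 1 by rewrite exprn_ge0 ?(ltW x0)// exprn_ile1// ltW.
apply/andP; split.
  by case/andP: y01 => y0 y1; rewrite exprn_ge0 ?subr_ge0.
have := @bernoulli_le _ (2 ^ n.+1) y01.
rewrite natrX -exprMn exprVn mulrC -ler_pdivlMr ?mul1r//.
by rewrite exprn_gt0// mulr_gt0.
Qed.

Let mD : measurable (`[0%R, +oo[%classic : set (measurableTypeR R)).
Proof. exact: measurable_itv. Qed.

Definition exp_integrable h : Prop := forall s, 0 < s ->
  lebesgue_measure.-integrable `[0, +oo[ (fun z => (expR (- (z * s)) * h z)%:E).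

(** Expanding one factor [1 - exp (- z r)] gives two instances of the case [N], at [s] and at
    [s + r]; hence [s] is quantified inside the induction. *)
Lemma exp_orthogonal h : exp_integrable h ->
  (forall s, 0 < s -> laplace h s = 0) ->
  forall (N : nat) s r, 0 < s -> 0 < r ->
  lebesgue_measure.-integrable `[0, +oo[
    (fun z => (expR (- (z * s)) * (1 - expR (- (z * r))) ^+ N * h z)%:E) /\
  \int[lebesgue_measure]_(z in `[0, +oo[)
    (expR (- (z * s)) * (1 - expR (- (z * r))) ^+ N * h z) = 0.
Proof.
move=> ih lh0; elim=> [|N IH] s r s0 r0.
  split.
    move: (ih s s0); apply: eq_integrable => // z _.
    by rewrite expr0 mulr1.
  transitivity (laplace h s); last exact: lh0.
  apply: eq_Rintegral => z _.
  by rewrite expr0 mulr1.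
have [i1 e1] := IH s r s0 r0.
have [i2 e2] := IH (s + r) r (addr_gt0 s0 r0) r0.
have E z : expR (- (z * s)) * (1 - expR (- (z * r))) ^+ N.+1 * h z =
    expR (- (z * s)) * (1 - expR (- (z * r))) ^+ N * h z -
    expR (- (z * (s + r))) * (1 - expR (- (z * r))) ^+ N * h z.
  by rewrite mulrDr opprD expRD exprS; ring.
split.
  move: (integrableB mD i1 i2).
  by apply: eq_integrable => // z _; rewrite E EFinB.
under eq_Rintegral do rewrite E.
by rewrite RintegralB// e1 e2 subrr.
Qed.

Lemma exp_tail_eq0 h a : exp_integrable h ->
  (forall s, 0 < s -> laplace h s = 0) -> 0 < a ->
  \int[lebesgue_measure]_(z in `]a, +oo[) (expR (- (z * 1)) * h z) = 0.
Proof.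
move=> ih lh0 a0.
pose k z := expR (- (z * 1)) * h z.
have ik : lebesgue_measure.-integrable `[0, +oo[ (EFin \o k) by exact: ih.
have mk := measurable_int lebesgue_measure ik.
(* This rate makes [exp (- z t) < 1/2] equivalent to [z > a], so the polynomials converge to the
   indicator of the tail beyond [a]. *)
pose t := ln 2 / a.
have t0 : 0 < t by rewrite divr_gt0// ln_gt0// ltr1n.
pose f n z := expR (- (z * 1)) *
  (1 - expR (- (z * (n.+1%:R * t)))) ^+ (2 ^ n.+1) * h z.
have fint n := @exp_orthogonal h ih lh0 (2 ^ n.+1) 1 (n.+1%:R * t) ltr01
  (mulr_gt0 (ltr0Sn _ n) t0).
have fE n z : f n z = (1 - expR (- (z * t)) ^+ n.+1) ^+ (2 ^ n.+1) * k z.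
  rewrite /f /k -mulrA mulrCA; congr ((1 - _) ^+ _ * _); rewrite -expRM_natl; congr expR.
  by rewrite mulrN mulrCA.
have at2 : a * t = ln 2 by rewrite /t mulrC divfK// gt_eqF.
have half : expR (- (a * t)) = 2^-1 :> R by rewrite at2 expRN lnK// posrE.
have e01 z : 0 <= z -> 0 <= expR (- (z * t)) <= 1.
  by move=> z0; rewrite expR_ge0 -expR0 ler_expR oppr_le0 mulr_ge0// ltW.
pose g : R -> R := k \_ `]a, +oo[.
have mg : measurable_fun (`[0%R, +oo[%classic : set (measurableTypeR R)) (EFin \o g).
  apply/measurable_EFinP; apply/measurable_restrict => //.
  by apply: measurable_funS mD _ _ => //; exact/measurable_EFinP.
have fg : {ae lebesgue_measure, forall z, (`[0, +oo[%classic : set R) z ->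
    (f n z)%:E @[n --> \oo] --> (EFin \o g) z}.
  (* At [z = a] the argument is exactly 1/2, where neither step lemma applies; this single point is
     null. *)
  exists [set a]; split => //; first exact: lebesgue_measure_set1.
  move=> z /= /not_implyP[/=]; rewrite in_itv/= andbT => z0.
  apply: contra_notP => /eqP za.
  apply: cvg_EFin; first exact: nearW.
  rewrite [X in X @ _ --> _](_ : _ = (fun n =>
      (1 - expR (- (z * t)) ^+ n.+1) ^+ (2 ^ n.+1) * k z)); last first.
    by apply/funext => n /=; rewrite fE.
  have /andP[x0 x1] := e01 z z0.
  rewrite /= /g patchE; case: ifPn; rewrite ?inE ?notin_setE/= in_itv/= andbT.
    move=> az; rewrite -[X in _ --> X]mul1r; apply: cvgMl; apply: cvg_step_lt => //.
    by rewrite -half ltr_expR ltrN2 ltr_pM2r.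
  move=> /negP; rewrite -leNgt le_eqVlt (negbTE za)/= => az.
  rewrite -[X in _ --> X](mul0r (k z)); apply: cvgMl; apply: cvg_step_gt => //.
  by rewrite -half ltr_expR ltrN2 ltr_pM2r.
have iabs := integrable_abse ik.
have fbound : {ae lebesgue_measure, forall z n, (`[0, +oo[%classic : set R) z ->
    (`|(f n z)%:E| <= (abse \o (EFin \o k)) z)%E}.
  apply: aeW => z n; rewrite /= in_itv/= andbT => z0.
  have /andP[y0 y1] := e01 z z0.
  rewrite lee_fin fE normrM ler_piMl//.
  have : 0 <= expR (- (z * t)) ^+ n.+1 <= 1 by rewrite exprn_ge0// exprn_ile1.
  move=> /andP[q0 q1]; rewrite ger0_norm ?exprn_ge0 ?subr_ge0//.
  by rewrite exprn_ile1 ?subr_ge0// gerBl.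
have [_ _ lim] := dominated_convergence mD
  (fun n => measurable_int lebesgue_measure (fint n).1) mg fg iabs fbound.
have e0 : (0 = \int[lebesgue_measure]_(z in `[0%R, +oo[) (EFin \o g) z)%E.
  apply: cvg_unique lim => //.
  rewrite (_ : [sequence _]_n = fun=> 0%E); first exact: cvg_cst.
  apply/funext => n /=; have [in_ en] := fint n.
  by rewrite -[LHS]fineK ?(integrable_fin_num mD in_)//; congr EFin; exact: en.
rewrite /Rintegral.
have -> : `]a, +oo[%classic = `[0%R, +oo[ `&` `]a, +oo[%classic :> set R.
  apply/seteqP; split=> z /=; rewrite !in_itv/= !andbT; last by case.
  by move=> az; split => //; rewrite ltW// (lt_trans a0).
rewrite integral_mkcondr; under eq_integral do rewrite restrict_EFin.
by rewrite -[X in fine X]e0.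
Qed.

(** If [h z] were positive, right-continuity would keep [h] above [h z / 2] on some interval to the
    right of [z]. The weighted integral there would be positive, yet it is a difference of two
    vanishing tails. *)
Lemma exp_le0 h z : exp_integrable h ->
  (forall s, 0 < s -> laplace h s = 0) -> 0 <= z ->
  h x @[x --> z^'+] --> h z -> h z <= 0.
Proof.
move=> ih lh0 z0 rc; rewrite leNgt; apply/negP => hz.
have : \forall x \near z^'+, h z / 2 < h x.
  by apply: (cvgr_gt (h z)) => //; lra.
move=> [e /= e0 He].
(* Starting strictly to the right of [z] makes [a] positive even for [z = 0], as [exp_tail_eq0]
   demands. *)
pose a := z + e / 4; pose b := z + e / 2.
have a0 : 0 < a by rewrite /a; lra.
have ab : a < b by rewrite /a /b; lra.
pose k x := expR (- (x * 1)) * h x.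
have ik : lebesgue_measure.-integrable `[0, +oo[ (EFin \o k) by exact: ih.
have iak : lebesgue_measure.-integrable `]a, +oo[ (EFin \o k).
  apply: integrableS ik => //; apply: subset_itvr.
  by rewrite bnd_simp ltW.
have iabk : lebesgue_measure.-integrable `]a, b] (EFin \o k).
  by apply: integrableS iak => //; exact: subset_itvl.
have := Rintegral_itvB (x := b) iak.
rewrite !bnd_simp (ltW ab) => /(_ isT isT).
rewrite !exp_tail_eq0//; last by rewrite (lt_trans a0).
rewrite sub0r => /eqP; rewrite oppr_eq0 => /eqP I0.
pose eta := expR (- b) * (h z / 2).
have eta0 : 0 < eta by rewrite mulr_gt0 ?expR_gt0//; lra.
have etak x : (`]a, b]%classic : set R) x -> eta <= k x.
  rewrite /= in_itv/= => /andP[ax xb].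
  rewrite /eta /k ler_pM ?expR_ge0//; [lra| |].
    by rewrite ler_expR mulr1 lerN2.
  apply/ltW/He; last by rewrite /a in ax; lra.
  rewrite /ball/= ltr_norml; move: ax xb; rewrite /a /b => ax xb.
  by apply/andP; split; lra.
have ieta : lebesgue_measure.-integrable `]a, b] (EFin \o (fun=> eta)).
  apply: le_integrable iabk => //; first exact: measurable_cst.
  move=> x xab; rewrite lee_fin.
  by rewrite !ger0_norm ?(ltW eta0) ?etak// (le_trans (ltW eta0) (etak x xab)).
have : eta * (b - a) <= \int[lebesgue_measure]_(x in `]a, b]) k x.
  have -> : b - a = fine (lebesgue_measure (`]a, b]%classic : set R)).
    by rewrite lebesgue_measure_itv/= lte_fin ab.
  by rewrite -Rintegral_cst//; exact: le_Rintegral.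
by rewrite I0 leNgt mulr_gt0// subr_gt0.
Qed.

(** The one-sided result is applied to the difference of the two functions in both orders. *)
Lemma laplace_class_inj g h : laplace_class g -> laplace_class h ->
  (forall s, 0 < s -> laplace g s = laplace h s) ->
  forall z, 0 <= z -> g z = h z.
Proof.
have key f1 f2 : laplace_class f1 -> laplace_class f2 ->
    (forall s, 0 < s -> laplace f1 s = laplace f2 s) ->
    forall z, 0 <= z -> f1 z <= f2 z.
  move=> [i1 c1] [i2 c2] e z z0; rewrite -subr_le0.
  apply: (@exp_le0 (fun x => f1 x - f2 x)) => //.
  - move=> s s0; move: (integrableB mD (i1 s s0) (i2 s s0)).
    by apply: eq_integrable => // x _; rewrite mulrBr EFinB.
  - move=> s s0; rewrite /laplace; under eq_Rintegral do rewrite mulrBr.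
    rewrite RintegralB//; [|exact: i1|exact: i2].
    by apply/eqP; rewrite subr_eq0; apply/eqP; exact: e.
  - by apply: cvgB; [exact: c1|exact: c2].
move=> cg ch e z z0; apply/eqP; rewrite eq_le !key// => s s0.
by rewrite e.
Qed.

End lerch.

(** * The Lindley recursion *)

Section lindley.
Context (R : realType) (d : measure_display) (Om : measurableType d)
  (A B : nat -> Om -> R).

(* The recursion runs backwards in time: step [j] comes last, so that
   [lindley n j] is the maximum of the walk started at time [j]. *)
Fixpoint lindley (n j : nat) (w : Om) : R :=
  if n is n'.+1 then Num.max 0 (A j w + lindley n' j.+1 w - B j w) else 0.

Lemma lindley_ge0 n j w : 0 <= lindley n j w.
Proof. by case: n => //= n; rewrite le_max lexx. Qed.

(** Unrolling the recursion yields the maximum of the partial sums; the clipping at 0 is the empty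
    sum [k = 0]. Speaking of upper bounds avoids forming that maximum. *)
Lemma lindley_le n j w z : lindley n j w <= z <->
  forall k, (k <= n)%N -> \sum_(i < k) (A (j + i) w - B (j + i) w) <= z.
Proof.
elim: n j z => [|n IH] j z /=.
  split=> [z0 k|/(_ 0%N isT)]; last by rewrite big_ord0.
  by rewrite leqn0 => /eqP ->; rewrite big_ord0.
have shift k : \sum_(i < k.+1) (A (j + i) w - B (j + i) w) =
    A j w - B j w + \sum_(i < k) (A (j.+1 + i) w - B (j.+1 + i) w).
  rewrite big_ord_recl addn0; congr (_ + _); apply: eq_bigr => i _.
  by rewrite /bump/= addnA addn1.
rewrite ge_max; split=> [/andP[z0 Hz] [_|k kn]|H].
- by rewrite big_ord0.
- rewrite shift -lerBrDl; move: k kn; apply/IH; lra.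
apply/andP; split; first by have := H 0%N isT; rewrite big_ord0.
suff : lindley n j.+1 w <= z - (A j w - B j w) by lra.
by apply/IH => k kn; rewrite lerBrDl -shift; exact: H.
Qed.

Lemma lindleyS n j w : lindley n j w <= lindley n.+1 j w.
Proof.
apply/lindley_le => k kn; move: (lexx (lindley n.+1 j w)) => /lindley_le.
by apply; rewrite ltnW.
Qed.

Lemma lindley_nd j w : {homo (fun n => lindley n j w) : n m / (n <= m)%N >-> n <= m}.
Proof. by apply: homo_leq => //; [exact: le_trans|move=> n; exact: lindleyS]. Qed.

(* Claims and gains as one family, so that a single index set can describe any
   part of the past or future; [true] marks the gains. *)
Definition claim_or_gain (i : bool * nat) : Om -> R :=
  if i.1 then B i.2 else A i.2.

(** A generating family rather than a sigma-algebra: it is meant as the argument of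
    [g_sigma_algebraType]. *)
Definition history (D : set (bool * nat)) : set (set Om) :=
  \bigcup_(i in D) preimage_set_system setT (claim_or_gain i) measurable.

Lemma measurable_history (D : set (bool * nat)) i : D i ->
  measurable_fun setT (claim_or_gain i : g_sigma_algebraType (history D) -> R).
Proof.
move=> Di _ C mC; apply: sub_sigma_algebra; exists i => //.
by exists C.
Qed.

(** The map [f] is an identity that changes the sigma-algebra: one proof serves both the ambient
    space and the coarser ones generated by a [history]. *)
Lemma measurable_lindley d' (T : measurableType d') (f : T -> Om) n j :
  (forall i, (j <= i)%N -> measurable_fun setT (A i \o f)) ->
  (forall i, (j <= i)%N -> measurable_fun setT (B i \o f)) ->
  measurable_fun setT (lindley n j \o f).
Proof.
elim: n j => [|n IH] j mA mB; first exact: measurable_cst.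
rewrite (_ : _ \o f = fun t => Num.max 0 ((A j \o f) t + (lindley n j.+1 \o f) t -
   (B j \o f) t))//.
apply: measurable_maxr => //; apply: measurable_funB; last exact: mB.
apply: measurable_funD; first exact: mA.
by apply: IH => i ji; [apply: mA|apply: mB]; exact: ltnW.
Qed.

End lindley.

Section lindley_law.
Context (R : realType) (d : measure_display) (Om : measurableType d)
  (P : probability Om R) (A B : nat -> Om -> R).
Hypotheses (mA : forall k, measurable_fun setT (A k))
  (mB : forall k, measurable_fun setT (B k))
  (indAB : independent_family P (claim_or_gain A B))
  (lawA : forall k (f : R -> \bar R), measurable_fun setT f ->
     (forall x, 0 <= f x)%E -> (\int[P]_w f (A k w) = \int[P]_w f (A 0%N w))%E)
  (lawB : forall k (f : R -> \bar R), measurable_fun setT f ->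
     (forall x, 0 <= f x)%E -> (\int[P]_w f (B k w) = \int[P]_w f (B 0%N w))%E).

Let mZ i : measurable_fun setT (claim_or_gain A B i).
Proof. by case: i => -[] k; [exact: mB|exact: mA]. Qed.

Lemma mlindley n j : measurable_fun setT (lindley A B n j).
Proof.
exact: (measurable_lindley (f := id) n (fun i _ => mA i) (fun i _ => mB i)).
Qed.

Lemma independent_history (D : set (bool * nat)) i (Y : Om -> R) : ~ D i ->
  measurable_fun setT (Y : g_sigma_algebraType (history A B D) -> R) ->
  independent2 P Y (claim_or_gain A B i).
Proof.
move=> Di mY C1 C2 mC1 mC2; rewrite setIC muleC.
apply: (independent_sigma_of mZ indAB Di mC2).
by rewrite -[X in sigma_of _ _ X]setTI; exact: mY.
Qed.

Lemma independent_claim_gain j (Y : Om -> R) :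
  measurable_fun setT
    (Y : g_sigma_algebraType (history A B [set i | i != (true, j)]) -> R) ->
  independent2 P Y (B j).
Proof.
by move=> mY; apply: (@independent_history _ (true, j)) mY; rewrite /= eqxx.
Qed.

(** The recursion started at [j.+1] reads indices above [j], so the gain of index [j] never
    enters. *)
Lemma measurable_claim_lindley n j : measurable_fun setT
  ((fun w => A j w + lindley A B n j.+1 w) :
    g_sigma_algebraType (history A B [set i | i != (true, j)]) -> R).
Proof.
apply: measurable_funD.
  exact: (@measurable_history _ _ _ A B [set i | i != (true, j)] (false, j)).
apply: (measurable_lindley (f := (id : g_sigma_algebraType _ -> Om))) => i ji.
  exact: (@measurable_history _ _ _ A B [set i | i != (true, j)] (false, i)).
apply: (@measurable_history _ _ _ A B [set i | i != (true, j)] (true, i)).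
by apply/eqP => -[ij]; move: ji; rewrite ij ltnn.
Qed.

Lemma independent_net_claim n j :
  independent2 P (fun w => A j w + lindley A B n j.+1 w) (B j).
Proof. by apply: independent_claim_gain; exact: measurable_claim_lindley. Qed.

Lemma independent_lindley n j : independent2 P (lindley A B n j.+1) (A j).
Proof.
apply: (@independent_history [set i | (j < i.2)%N] (false, j)); first by rewrite /= ltnn.
apply: (measurable_lindley (f := (id : g_sigma_algebraType _ -> Om))) => i ji.
  exact: (@measurable_history _ _ _ A B [set i | (j < i.2)%N] (false, i)).
exact: (@measurable_history _ _ _ A B [set i | (j < i.2)%N] (true, i)).
Qed.

(** The law does not depend on the starting time. By induction on [n]: gain, claim and remaining
    recursion are independent, so they are integrated separately, and each law is replaced by its
    copy at time 0. *)
Lemma lindley_law n j (f : R -> \bar R) : measurable_fun setT f ->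
  (forall x, 0 <= f x)%E ->
  (\int[P]_w f (lindley A B n j w) = \int[P]_w f (lindley A B n 0 w))%E.
Proof.
elim: n j f => // n IH j f mf f0.
(* The right-hand side is free of [i]; comparing [i = j] with [i = 0] finishes the induction
   step. *)
have key i : (\int[P]_w f (lindley A B n.+1 i w) =
    \int[P]_b \int[P]_a \int[P]_l
      f (Num.max 0 (A 0%N a + lindley A B n 0 l - B 0%N b))%R)%E.
  pose g (p : R * R) := f (Num.max 0 (p.2 - p.1)).
  have mg : measurable_fun setT g.
    apply: (measurableT_comp mf); apply: measurable_maxr => //.
    exact: measurable_funB.
  pose H w := A i w + lindley A B n i.+1 w.
  have mH : measurable_fun setT H by apply: measurable_funD => //; exact: mlindley.
  have indBH : independent2 P (B i) H.
    move=> C1 C2 mC1 mC2; rewrite setIC muleC; exact: independent_net_claim.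
  transitivity (\int[P]_b \int[P]_w g (B i b, H w))%E.
    exact: (ge0_integral_independent2 (mB i) mH indBH mg (fun p => f0 _)).
  have step b : (\int[P]_w g (b, H w) =
      \int[P]_a \int[P]_l g (b, A 0%N a + lindley A B n 0 l)%R)%E.
    pose g' (p : R * R) := g (b, p.1 + p.2).
    have mg' : measurable_fun setT g'.
      apply: (measurableT_comp mg); apply: measurable_fun_pair => //.
      exact: measurable_funD.
    have indAL : independent2 P (A i) (lindley A B n i.+1).
      move=> C1 C2 mC1 mC2; rewrite setIC muleC; exact: independent_lindley.
    transitivity (\int[P]_a \int[P]_l g' (A i a, lindley A B n i.+1 l))%E.
      exact: (ge0_integral_independent2 (mA i) (mlindley n i.+1) indAL mg'
        (fun p => f0 _)).
    transitivity (\int[P]_a \int[P]_l g' (A i a, lindley A B n 0 l))%E.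
      apply: eq_integral => a _; apply: (IH i.+1 (fun x => g' (A i a, x)));
        last by move=> x; exact: f0.
      by apply: (measurableT_comp mg'); exact: measurable_fun_pair.
    pose F x := (\int[P]_l g' (x, lindley A B n 0 l))%E.
    have mF : measurable_fun setT F.
      apply: (measurable_fun_fubini_tonelli_F (m2 := P)
        (fun p : R * Om => g' (p.1, lindley A B n 0 p.2))) => [|p]; last exact: f0.
      apply: (measurableT_comp mg'); apply: measurable_fun_pair => //.
      exact: (measurableT_comp (mlindley n 0)).
    have F0 x : (0 <= F x)%E by apply: integral_ge0 => l _; exact: f0.
    exact: (lawA i mF F0).
  under eq_integral do rewrite step.
  pose F x := (\int[P]_a \int[P]_l g (x, A 0%N a + lindley A B n 0 l)%R)%E.
  (* Two applications of Tonelli measurability, one for each inner integral, so that [lawB] may be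
     used on [F]. *)
  have mF : measurable_fun setT F.
    pose F' (p : R * Om) := (\int[P]_l g (p.1, A 0%N p.2 + lindley A B n 0 l)%R)%E.
    apply: (measurable_fun_fubini_tonelli_F (m2 := P) F'); last first.
      by move=> p; apply: integral_ge0 => l _; exact: f0.
    apply: (measurable_fun_fubini_tonelli_F (m2 := P)
      (fun p : R * Om * Om => g (p.1.1, A 0%N p.1.2 + lindley A B n 0 p.2)))
      => [|p]; last exact: f0.
    apply: (measurableT_comp mg); apply: measurable_fun_pair.
      exact: measurableT_comp.
    apply: measurable_funD.
      by apply: (measurableT_comp (mA 0)); exact: measurableT_comp.
    exact: (measurableT_comp (mlindley n 0)).
  have F0 x : (0 <= F x)%E.
    by apply: integral_ge0 => a _; apply: integral_ge0 => l _; exact: f0.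
  exact: (lawB i mF F0).
by rewrite (key j) (key 0%N).
Qed.

End lindley_law.

(** * The transform of a claim near zero and its mean *)

Section mean_transform.
Context (R : realType) (d : measure_display) (Om : measurableType d)
  (P : probability Om R) (A : Om -> R) (m : R).
Hypotheses (mA : measurable_fun setT A) (A0 : forall w, 0 <= A w)
  (EA : (\int[P]_w (A w)%:E = m%:E)%E).

Let iA : P.-integrable setT (EFin \o A).
Proof.
apply/integrableP; split; first exact/measurable_EFinP.
under eq_integral do rewrite /= ger0_norm//.
by rewrite EA ltry.
Qed.

Let RA : \int[P]_w A w = m.
Proof. by rewrite /Rintegral EA. Qed.

Let i1 : P.-integrable setT (EFin \o (fun=> 1 : R)).
Proof. exact: finite_measure_integrable_cst. Qed.

Let R1 : \int[P]_w (1 : R) = 1.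
Proof. rewrite Rintegral_cst// mul1r; exact: (congr1 fine (probability_setT P)). Qed.

Lemma one_sub_lst s : 0 <= s -> 1 - lst P A s = \int[P]_w (1 - expR (- (s * A w))).
Proof. by move=> s0; rewrite RintegralB ?R1//; exact: integrable_expRN. Qed.

Let i1e s : 0 <= s -> P.-integrable setT (EFin \o (fun w => 1 - expR (- (s * A w)))).
Proof.
move=> s0; apply: integrable_le1.
  by apply: measurable_funB => //; exact: measurable_expRN.
by move=> w; rewrite subr_ge0 expRN_le1//= gerBl expR_ge0.
Qed.

Let isA s : P.-integrable setT (EFin \o (fun w => s * A w)).
Proof. exact: (integrableZl measurableT s iA). Qed.

Lemma one_sub_lst_le s : 0 <= s -> 1 - lst P A s <= s * m.
Proof.
move=> s0; rewrite one_sub_lst// -RA -RintegralZl//.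
apply: le_Rintegral => //; first exact: i1e.
by move=> w _; have := expR_ge1Dx (- (s * A w)); lra.
Qed.

(** Equality would force the nonnegative gap [x - (1 - exp (- x))], [x = s * A], to vanish almost
    surely, whereas it is positive wherever [A > 0]. *)
Lemma one_sub_lst_lt s : {ae P, forall w, 0 < A w} -> 0 < s ->
  1 - lst P A s < s * m.
Proof.
move=> Apos s0; rewrite lt_neqAle one_sub_lst_le ?ltW// andbT; apply/eqP => e.
pose g w := s * A w - (1 - expR (- (s * A w))).
have g0 w : 0 <= g w by rewrite /g; have := expR_ge1Dx (- (s * A w)); lra.
have ig : P.-integrable setT (EFin \o g).
  exact: (integrableB measurableT (isA s) (i1e (ltW s0))).
have : (\int[P]_w (g w)%:E = 0)%E.
  rewrite -[LHS]fineK ?(integrable_fin_num measurableT ig)//; congr EFin.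
  have -> : fine (\int[P]_w (g w)%:E) = \int[P]_w g w by [].
  rewrite /g RintegralB//; last exact: i1e (ltW s0).
  by rewrite -one_sub_lst ?ltW// RintegralZl// RA e subrr.
move=> Ig.
have mg : measurable_fun setT (EFin \o g) by exact: measurable_int ig.
have : (\int[P]_(w in setT) `|(EFin \o g) w| = 0)%E.
  by rewrite -Ig; apply: eq_integral => w _; rewrite /= ger0_norm.
move/(ae_eq_integral_abs P measurableT mg) => gae.
have : P.-negligible (~` set0).
  move: gae Apos; apply: filterS2 => w /= /(_ I) [gw] Aw.
  have := @expR_gt1Dx R (- (s * A w)); rewrite oppr_eq0 mulf_neq0 ?gt_eqF//.
  by move: gw; rewrite /g; lra.
rewrite setC0 => /(measure_negligible measurableT).
by move/(etrans (esym (probability_setT P)))/eqP; rewrite onee_eq0.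
Qed.

(** The mean is minus the derivative of the transform at 0, taken along [1 / (n + 1)]: dominated
    convergence with [A] itself as the bound. *)
Lemma one_sub_lst_cvg :
  (1 - lst P A n.+1%:R^-1) * n.+1%:R @[n --> \oo] --> m.
Proof.
pose f n w := (1 - expR (- (n.+1%:R^-1 * A w))) * n.+1%:R.
have n0 n : 0 < n.+1%:R^-1 :> R by rewrite invr_gt0.
have i_f n : P.-integrable setT (EFin \o f n).
  exact: (integrableZr measurableT _ (i1e (ltW (n0 n)))).
have fE n : (1 - lst P A n.+1%:R^-1) * n.+1%:R = \int[P]_w f n w.
  by rewrite one_sub_lst ?(ltW (n0 n))// RintegralZr//; exact: i1e (ltW (n0 n)).
under eq_fun do rewrite fE.
have fle n w : 0 <= f n w <= A w.
  apply/andP; split.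
    by rewrite mulr_ge0// subr_ge0 expRN_le1// ltW.
  rewrite -ler_pdivlMr// [A w / _]mulrC.
  by have := expR_ge1Dx (- (n.+1%:R^-1 * A w)); set x := _^-1 * A w; lra.
(* From [exp x >= 1 + x] comes [1 - exp (- x) >= x / (1 + x)], the lower half of the squeeze. *)
have fge n w : A w / (1 + n.+1%:R^-1 * A w) <= f n w.
  have x0 : 0 <= n.+1%:R^-1 * A w by rewrite mulr_ge0// ltW.
  rewrite /f expRN; set x := _ * A w in x0 *.
  have e1 := expR_ge1Dx x.
  have x1 : 0 < 1 + x by lra.
  have -> : A w = x * n.+1%:R by rewrite /x mulrAC mulVf ?mul1r ?pnatr_eq0.
  rewrite mulrAC ler_pM2r//.
  have -> : x / (1 + x) = 1 - (1 + x)^-1 by field; rewrite gt_eqF.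
  by rewrite lerB// lef_pV2 ?posrE ?expR_gt0.
apply: fine_cvg; rewrite -EA.
have mf n : measurable_fun setT (EFin \o f n) := measurable_int P (i_f n).
have f_cvg : {ae P, forall w, setT w -> (EFin \o f n) w @[n --> \oo] --> (EFin \o A) w}.
  apply: aeW => w _; apply: cvg_EFin; first exact: nearW.
  apply: (squeeze_cvgr (f := fun n => A w / (1 + n.+1%:R^-1 * A w)) (h := fun=> A w)).
  + by apply: nearW => n; rewrite fge; case/andP: (fle n w).
  + have c1 : 1 + n.+1%:R^-1 * A w @[n --> \oo] --> (1 : R).
      rewrite -[X in _ --> X]addr0; apply: cvgD; first exact: cvg_cst.
      by rewrite -[X in _ --> X](mul0r (A w)); apply: cvgMl; exact: cvg_harmonic.
    rewrite -[X in _ --> X]divr1; apply: cvgMr.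
    by apply: cvgV c1; exact: oner_neq0.
  + exact: cvg_cst.
have f_le : {ae P, forall w n, setT w -> (`|(EFin \o f n) w| <= (EFin \o A) w)%E}.
  apply: aeW => w n _; have /andP[f0 f1] := fle n w.
  by rewrite /= lee_fin ger0_norm.
by have [] := dominated_convergence measurableT mf (measurable_int P iA) f_cvg iA f_le.
Qed.

End mean_transform.

(** * The limit of the Lindley transforms *)

Section lindley_transform.
Context (R : realType) (d : measure_display) (Om : measurableType d)
  (P : probability Om R) (A B : nat -> Om -> R) (mu m : R).
Hypotheses (mA : forall k, measurable_fun setT (A k))
  (mB : forall k, measurable_fun setT (B k))
  (A0 : forall k w, 0 <= A k w) (B0 : forall k w, 0 <= B k w)
  (indAB : independent_family P (claim_or_gain A B))
  (lawA : forall k (f : R -> \bar R), measurable_fun setT f ->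
     (forall x, 0 <= f x)%E -> (\int[P]_w f (A k w) = \int[P]_w f (A 0%N w))%E)
  (lawB : forall k (f : R -> \bar R), measurable_fun setT f ->
     (forall x, 0 <= f x)%E -> (\int[P]_w f (B k w) = \int[P]_w f (B 0%N w))%E)
  (PB : forall t, 0 <= t -> P [set w | t < B 0%N w] = (expR (- (mu * t)))%:E)
  (mu0 : 0 < mu) (EA : (\int[P]_w (A 0%N w)%:E = m%:E)%E)
  (Apos : {ae P, forall w, 0 < A 0%N w}) (load : mu * m <= 1).

Let phi s := lst P (A 0%N) s.
Let psi n s := lst P (lindley A B n 0) s.
Let ml n j : measurable_fun setT (lindley A B n j) := mlindley mA mB n j.

Lemma lst_lindley_shift n j s : lst P (lindley A B n j) s = psi n s.
Proof.
rewrite /psi /lst /Rintegral; congr fine.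
apply: (lindley_law mA mB indAB lawA lawB n j (f := fun x => (expR (- (s * x)))%:E)).
  by apply/measurable_EFinP; exact: measurable_expRN.
by move=> x; rewrite lee_fin expR_ge0.
Qed.

(** This is [lst_overshoot] for the claim plus the recursion started at time 1. The transform of
    that sum factors, and stationarity moves the start back to time 0. *)
Lemma lst_lindleyS n s : 0 < s -> s != mu ->
  (mu - s) * psi n.+1 s = mu * (phi s * psi n s) - s * (phi mu * psi n mu).
Proof.
move=> s0 smu.
have H0 w : 0 <= A 0%N w + lindley A B n 1 w by rewrite addr_ge0// lindley_ge0.
have mH : measurable_fun setT (fun w => A 0%N w + lindley A B n 1 w).
  exact: measurable_funD.
rewrite /psi [lst _ _ s](_ : _ =
  lst P (fun w => Num.max 0 ((A 0%N w + lindley A B n 1 w) - B 0%N w)) s)//.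
rewrite (lst_overshoot (mB 0) mH (B0 0) H0 (independent_net_claim mA mB indAB n 0) PB)//.
have indAL : independent2 P (A 0%N) (lindley A B n 1).
  by move=> C1 C2 mC1 mC2; rewrite setIC muleC; exact: (independent_lindley mA mB indAB).
have L0 w : 0 <= lindley A B n 1 w by exact: lindley_ge0.
rewrite !(lst_add (mA 0) (ml n 1) (A0 0) L0 indAL) ?ltW//.
by rewrite !lst_lindley_shift.
Qed.

Let psi_le1 n s : 0 <= s -> psi n s <= 1.
Proof. by move=> s0; apply: lst_le1 => // w; exact: lindley_ge0. Qed.

Let psi_ge0 n s : 0 <= psi n s. Proof. exact: lst_ge0. Qed.

Let psiS n s : 0 <= s -> psi n.+1 s <= psi n s.
Proof.
move=> s0; apply: le_lst => // w; first exact: lindley_ge0.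
exact: lindleyS.
Qed.

Let cvg_psi s : 0 <= s -> cvgn (psi ^~ s).
Proof.
move=> s0; apply: nonincreasing_is_cvgn.
  by apply/nonincreasing_seqP => n; exact: psiS.
by exists 0 => _ [n _ <-].
Qed.

Let c := phi mu * limn (psi ^~ mu).

Let cvg_c : phi mu * psi n mu @[n --> \oo] --> c.
Proof. by apply: cvgMr; apply: cvg_psi; exact: ltW. Qed.

Let one_sub_phi s : 0 <= s -> 1 - phi s <= s * m.
Proof. exact: one_sub_lst_le. Qed.

(** Pass to the limit in [lst_lindleyS]. At the excluded point [s = mu] the identity is the
    definition of [c]. *)
Let lim_eq s : 0 < s -> limn (psi ^~ s) * (s - mu * (1 - phi s)) = s * c.
Proof.
move=> s0; have [->|smu] := eqVneq s mu; first by rewrite /c; ring.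
have /cvg_lim : (mu - s) * psi n.+1 s @[n --> \oo] --> (mu - s) * limn (psi ^~ s).
  by apply: cvgMr; rewrite (cvg_shiftS (psi ^~ s)); apply: cvg_psi; exact: ltW.
move=> /(_ (@Rhausdorff R)) e1.
have /cvg_lim : (mu - s) * psi n.+1 s @[n --> \oo] -->
    mu * (phi s * limn (psi ^~ s)) - s * c.
  rewrite (_ : (fun n => _) =
      (fun n => mu * (phi s * psi n s) - s * (phi mu * psi n mu))).
    apply: cvgB; last exact: cvgMr.
    by apply: cvgMr; apply: cvgMr; apply: cvg_psi; exact: ltW.
  by apply/funext => n; rewrite lst_lindleyS.
move=> /(_ (@Rhausdorff R)); rewrite e1; lra.
Qed.

(** For [s < mu], monotonicity in [n] and [1 - phi s <= s m] turn the recursion into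
    [psi_n(s) (1 - mu m) <= c_n]. Let [s] tend to 0 with [n] fixed, where [psi_n(s)] tends to 1, and
    then [n] to infinity. *)
Let c_ge : 1 - mu * m <= c.
Proof.
have cn n : 1 - mu * m <= phi mu * psi n mu.
  have step s : 0 < s -> s < mu -> psi n s * (1 - mu * m) <= phi mu * psi n mu.
    move=> s0 smu; rewrite -(ler_pM2l s0).
    have := lst_lindleyS n s0 (negbT (lt_eqF smu)).
    have : (mu - s) * psi n.+1 s <= (mu - s) * psi n s.
      by apply: ler_wpM2l; [rewrite subr_ge0 ltW|apply: psiS; exact: ltW].
    have : psi n s * (mu * (1 - phi s)) <= psi n s * (mu * (s * m)).
      apply: ler_wpM2l => //; apply: ler_wpM2l; first exact: ltW.
      by apply: one_sub_phi; exact: ltW.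
    move=> h1 h2 h3; nra.
  have l1 : psi n k.+1%:R^-1 * (1 - mu * m) @[k --> \oo] --> 1 * (1 - mu * m).
    by apply: cvgMl; apply: lst_cvg1 => // w; exact: lindley_ge0.
  rewrite -[X in X <= _]mul1r -(cvg_lim (@Rhausdorff R) l1).
  apply: limr_le; first by apply/cvg_ex; eexists; exact: l1.
  have : k.+1%:R^-1 @[k --> \oo] --> (0 : R) by exact: cvg_harmonic.
  move=> /cvgr_lt/(_ mu mu0); apply: filterS => k kmu.
  by apply: step.
rewrite -(cvg_lim (@Rhausdorff R) cvg_c).
apply: limr_ge; first by apply/cvg_ex; eexists; exact: cvg_c.
by apply: nearW.
Qed.

(** In [lim_eq] the limit is at most 1 and, by [load], its cofactor is nonnegative; divide by [s]
    and let [s = 1 / (n + 1)] tend to 0. *)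
Let c_le : c <= 1 - mu * m.
Proof.
have l : 1 - mu * ((1 - phi n.+1%:R^-1) * n.+1%:R) @[n --> \oo] --> 1 - mu * m.
  apply: cvgB; first exact: cvg_cst.
  by apply: cvgMr; exact: one_sub_lst_cvg.
rewrite -(cvg_lim (@Rhausdorff R) l).
apply: limr_ge; first by apply/cvg_ex; eexists; exact: l.
apply: nearW => n.
set s := n.+1%:R^-1 : R; have s0 : 0 < s by rewrite invr_gt0.
have -> : n.+1%:R = s^-1 by rewrite invrK.
rewrite -(ler_pM2l s0) -lim_eq//.
have -> : s * (1 - mu * ((1 - phi s) / s)) = 1 * (s - mu * (1 - phi s)).
  by field; rewrite gt_eqF.
rewrite ler_wpM2r//.
  have := ler_wpM2l (ltW mu0) (one_sub_phi (ltW s0)).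
  by have := ler_wpM2l (ltW s0) load; lra.
apply: limr_le; first by apply: cvg_psi; exact: ltW.
by apply: nearW => k; apply: psi_le1; exact: ltW.
Qed.

(** Strictness comes from [one_sub_lst_lt], so the denominator stays positive even when
    [mu m = 1]. *)
Lemma lindley_transform_gt0 s : 0 < s -> 0 < s - mu * (1 - phi s).
Proof.
move=> s0; have := one_sub_lst_lt (mA 0) (A0 0) EA Apos s0.
rewrite -/(phi s) -(ltr_pM2l mu0).
by have := ler_wpM2l (ltW s0) load; lra.
Qed.

(** The Pollaczek-Khinchine formula, obtained by solving [lim_eq] with [c = 1 - mu m]. *)
Lemma cvg_lst_lindley s : 0 < s ->
  psi n s @[n --> \oo] --> s * (1 - mu * m) / (s - mu * (1 - phi s)).
Proof.
move=> s0; have -> : s * (1 - mu * m) / (s - mu * (1 - phi s)) = limn (psi ^~ s).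
  have -> : 1 - mu * m = c by apply/eqP; rewrite eq_le c_ge c_le.
  by rewrite -lim_eq// mulfK// gt_eqF// lindley_transform_gt0.
by apply: cvg_psi; exact: ltW.
Qed.

End lindley_transform.

(** * The supremum of the walk *)

Section walk_supremum.
Context (R : realType) (d : measure_display) (Om : measurableType d)
  (P : probability Om R) (A B : nat -> Om -> R) (mu : R).

Definition walk (n : nat) (w : Om) : R := \sum_(i < n) (A i w - B i w).

Definition walk_sup (w : Om) : \bar R :=
  ereal_sup [set (walk n w)%:E | n in [set n | (1 <= n)%N]].

Definition lindley_sup (j : nat) (w : Om) : \bar R :=
  ereal_sup (range (fun n => (lindley A B n j w)%:E)).

Lemma walk_sup_le w z : (walk_sup w <= z%:E)%E <->
  forall n, (1 <= n)%N -> walk n w <= z.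
Proof.
split=> [H n n1|H].
  by rewrite -lee_fin; apply: le_trans H; apply: ereal_sup_ubound; exists n.
by apply: ge_ereal_sup => _ [n n1 <-]; rewrite lee_fin; exact: H.
Qed.

(** A supremum strictly below [z] stays below [z - 1 / (k + 1)] for some [k]; this presents the
    event as a countable union of closed ones. *)
Lemma walk_sup_lt w z : (walk_sup w < z%:E)%E <->
  exists k : nat, forall n, (1 <= n)%N -> walk n w <= z - k.+1%:R^-1.
Proof.
split=> [H|[k /walk_sup_le /le_lt_trans]]; last first.
  by apply; rewrite lte_fin ltrBlDr ltrDl invr_gt0.
case E : (walk_sup w) H => [r| |]//.
- rewrite lte_fin => rz.
  have [k kz] : exists k : nat, k.+1%:R^-1 < z - r.
    exists (Num.truncn (z - r)^-1); rewrite invf_plt ?posrE ?subr_gt0//.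
    exact: truncnS_gt.
  by exists k; apply/walk_sup_le; rewrite E lee_fin lerBrDr -lerBrDl; exact: ltW.
(* The value [-oo] is impossible, as it would put [walk 1 w] below [walk 1 w - 1]. *)
- move=> _; have /walk_sup_le/(_ 1%N isT) : (walk_sup w <= (walk 1 w - 1)%:E)%E.
    by rewrite E leNye.
  by rewrite lerBrDr gerDl ler10.
Qed.

Lemma lindley_sup_le j w z : (lindley_sup j w <= z%:E)%E <->
  forall n, lindley A B n j w <= z.
Proof.
split=> [H n|H].
  by rewrite -lee_fin; apply: le_trans H; apply: ereal_sup_ubound; exists n.
by apply: ge_ereal_sup => _ [n _ <-]; rewrite lee_fin; exact: H.
Qed.

Lemma lindley_sup_ge0 j w : (0 <= lindley_sup j w)%E.
Proof. by apply: ereal_sup_ubound; exists 0%N. Qed.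

(** The two suprema differ by the empty sum 0, which a bound [z >= 0] does not notice. *)
Lemma lindley_sup0_le w z : 0 <= z ->
  (lindley_sup 0 w <= z%:E)%E <-> (walk_sup w <= z%:E)%E.
Proof.
move=> z0; rewrite lindley_sup_le walk_sup_le; split=> H n.
  by move=> _; have /lindley_le/(_ n (leqnn n)) := H n.
by apply/lindley_le => -[|k] _; [rewrite big_ord0|exact: H].
Qed.

(** Every nonempty partial sum contains the first step, so the first gain can be split off from a
    supremum over later steps. *)
Lemma walk_sup_shift w z : walk_sup w = z%:E ->
  A 0%N w + fine (lindley_sup 1 w) - B 0%N w = z.
Proof.
move=> Ez.
have walkS k : walk k.+1 w =
    A 0%N w - B 0%N w + \sum_(i < k) (A (1 + i)%N w - B (1 + i)%N w).
  by rewrite /walk big_ord_recl.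
have le1 y : (forall n, (1 <= n)%N -> walk n w <= y) <->
    (lindley_sup 1 w <= (y - (A 0%N w - B 0%N w))%:E)%E.
  rewrite lindley_sup_le; split=> H n.
    by apply/lindley_le => k _; rewrite lerBrDl -walkS; exact: H.
  case: n => // n _; rewrite walkS -lerBrDl.
  by have /lindley_le/(_ n (leqnn n)) := H n.
have /walk_sup_le/le1 lez : (walk_sup w <= z%:E)%E by rewrite Ez.
have Ef : (fine (lindley_sup 1 w))%:E = lindley_sup 1 w.
  apply: fineK; rewrite ge0_fin_numE ?lindley_sup_ge0//.
  exact: le_lt_trans lez (ltry _).
set s := fine _ in Ef *; move: lez; rewrite -Ef lee_fin => lez.
(* Choosing the bound in [le1] so that it is met with equality gives the reverse inequality. *)
have /le1/walk_sup_le : (lindley_sup 1 w <=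
    (A 0%N w - B 0%N w + s - (A 0%N w - B 0%N w))%:E)%E.
  by rewrite -Ef lee_fin; lra.
by rewrite Ez lee_fin; lra.
Qed.

Lemma measurable_lindley_sup d' (T : measurableType d') (f : T -> Om) j :
  (forall i, (j <= i)%N -> measurable_fun setT (A i \o f)) ->
  (forall i, (j <= i)%N -> measurable_fun setT (B i \o f)) ->
  measurable_fun setT (lindley_sup j \o f).
Proof.
move=> mA mB.
apply: (emeasurable_fun_cvg (fun n => EFin \o (lindley A B n j \o f))).
  by move=> n; apply/measurable_EFinP; exact: measurable_lindley.
move=> t _; apply: ereal_nondecreasing_cvgn => n k nk.
by rewrite lee_fin lindley_nd.
Qed.

Hypotheses (mA : forall k, measurable_fun setT (A k))
  (mB : forall k, measurable_fun setT (B k))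
  (B0 : forall k w, 0 <= B k w)
  (indAB : independent_family P (claim_or_gain A B))
  (PB : forall t, 0 <= t -> P [set w | t < B 0%N w] = (expR (- (mu * t)))%:E).

(** For [y > 0] an atom is at most the drop of the tail from [y - e] to [y], which vanishes with [e]
    by continuity. At 0 the tail is already 1, and below 0 the event is empty. *)
Lemma exponential_no_atom y : P [set w | B 0%N w = y] = 0%E.
Proof.
have mlt t : measurable [set w | t < B 0%N w].
  rewrite (_ : [set w | _] = B 0%N @^-1` `]t, +oo[).
    exact: measurable_preimage_itv.
  by apply/seteqP; split=> w /=; rewrite in_itv/= andbT.
have meq : measurable [set w | B 0%N w = y].
  by rewrite -[X in measurable X]setTI; exact: (mB 0 measurableT (measurable_set1 _)).
have [y0|y0] := ltP y 0.
  rewrite (_ : [set w | _] = set0) ?measure0//.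
  by rewrite -subset0 => w /= By; have := B0 0 w; rewrite By leNgt y0.
have disj : [set w | y < B 0%N w] `&` [set w | B 0%N w = y] = set0.
  by rewrite -subset0 => w /= [yB By]; move: yB; rewrite By ltxx.
have PU : P ([set w | y < B 0%N w] `|` [set w | B 0%N w = y]) =
    ((expR (- (mu * y)))%:E + P [set w | B 0%N w = y])%E.
  by rewrite -PB//; exact: measureU.
pose p := fine (P [set w | B 0%N w = y]).
have pE : P [set w | B 0%N w = y] = p%:E by rewrite fineK ?fin_num_measure.
rewrite pE in PU *; rewrite -EFinD in PU; congr EFin.
have p0 : 0 <= p by rewrite fine_ge0.
have [y_eq0|y_gt0] := leP y 0.
  have yE : y = 0 by apply/eqP; rewrite eq_le y_eq0.
  move: PU; rewrite (_ : _ `|` _ = setT).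
    rewrite probability_setT yE mulr0 oppr0 expR0 => -[]; lra.
  apply/seteqP; split=> // w _ /=; rewrite yE; have := B0 0 w.
  by rewrite le_eqVlt => /predU1P[<-|]; [right|left].
have bound e : 0 < e -> e <= y -> p <= expR (- (mu * (y - e))) - expR (- (mu * y)).
  move=> e0 ey; rewrite lerBrDl -lee_fin -PU -PB ?subr_ge0// le_measure ?inE//.
    exact: measurableU.
  by move=> w /= [|->]; [apply: le_lt_trans|]; rewrite ?gerBl ?ltW// gtrBl.
have l : expR (- (mu * (y - y * n.+1%:R^-1))) - expR (- (mu * y))
    @[n --> \oo] --> (0 : R).
  rewrite -[X in _ --> X](subrr (expR (- (mu * y)))); apply: cvgB; last exact: cvg_cst.
  apply: continuous_cvg; first exact: continuous_expR.
  apply: cvgN; apply: cvgMr; rewrite -[X in _ --> X]subr0; apply: cvgB.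
    exact: cvg_cst.
  by rewrite -[X in _ --> X](mulr0 y); apply: cvgMr; exact: cvg_harmonic.
apply/eqP; rewrite eq_le p0 andbT -(cvg_lim (@Rhausdorff R) l).
apply: limr_ge; first by apply/cvg_ex; eexists; exact: l.
apply: nearW => n; apply: bound; first by rewrite mulr_gt0// invr_gt0.
by rewrite ler_piMr ?invf_le1// ?ler1n ?ltW.
Qed.

Lemma measurable_walk n : measurable_fun setT (walk n).
Proof. by apply: measurable_sum => i; exact: measurable_funB. Qed.

Lemma measurable_walk_sup_le z : measurable [set w | (walk_sup w <= z%:E)%E].
Proof.
rewrite (_ : [set w | _] = \bigcap_n (walk n.+1 @^-1` `]-oo, z])).
  apply: bigcapT_measurable => n; apply: measurable_preimage_itv.
  exact: measurable_walk.
apply/seteqP; split=> w /=.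
  by move=> /walk_sup_le H n _; rewrite /= in_itv/=; exact: H.
move=> H; apply/walk_sup_le => -[//|n] _; have := H n I.
by rewrite /= in_itv.
Qed.

Lemma measurable_walk_sup_lt z : measurable [set w | (walk_sup w < z%:E)%E].
Proof.
rewrite (_ : [set w | _] =
    \bigcup_k [set w | (walk_sup w <= (z - k.+1%:R^-1)%:E)%E]).
  by apply: bigcupT_measurable => k; exact: measurable_walk_sup_le.
apply/seteqP; split=> w /=.
  by move=> /walk_sup_lt [k H]; exists k => //; apply/walk_sup_le.
by move=> [k _ /walk_sup_le H]; apply/walk_sup_lt; exists k.
Qed.

(** The event lies in [H - B_0 = z] with [H] independent of the first gain; given [H], this is a
    single value of that gain. Where [lindley_sup] is infinite [fine] returns 0, which is harmless
    for an inclusion. *)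
Lemma walk_sup_no_atom z : P [set w | walk_sup w = z%:E] = 0%E.
Proof.
pose H w := A 0%N w + fine (lindley_sup 1 w).
have mHh : measurable_fun setT
    (H : g_sigma_algebraType (history A B [set i | i != (true, 0%N)]) -> R).
  apply: measurable_funD.
    exact: (@measurable_history _ _ _ A B [set i | i != (true, 0%N)] (false, 0%N)).
  apply: (measurableT_comp (fine_measurable measurableT)).
  apply: (measurable_lindley_sup (f := (id : g_sigma_algebraType _ -> Om))) => i i1.
    exact: (@measurable_history _ _ _ A B [set i | i != (true, 0%N)] (false, i)).
  apply: (@measurable_history _ _ _ A B [set i | i != (true, 0%N)] (true, i)).
  by apply/eqP => -[i0]; move: i1; rewrite i0.
have mH : measurable_fun setT H.
  apply: measurable_funD; first exact: mA.
  apply: (measurableT_comp (fine_measurable measurableT)).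
  exact: (measurable_lindley_sup (f := id) (fun i _ => mA i) (fun i _ => mB i)).
have indHB := independent_claim_gain mA mB indAB mHh.
pose E := [set p : R * R | p.1 - p.2 = z].
have mE : measurable E.
  have mf : measurable_fun setT (fun p : R * R => p.1 - p.2).
    exact: measurable_funB.
  by move: (mf measurableT _ (measurable_set1 z)); rewrite setTI.
have mN : measurable [set w | H w - B 0%N w = z].
  have mf : measurable_fun setT (fun w => H w - B 0%N w).
    exact: measurable_funB.
  by rewrite -[X in measurable X]setTI; exact: (mf measurableT _ (measurable_set1 z)).
have indE h b : \1_E (h, b) = (h - b == z)%:R :> R.
  by rewrite indicE; congr (nat_of_bool _)%:R; apply/idP/eqP; rewrite inE.
have N0 : P [set w | H w - B 0%N w = z] = 0%E.
  have -> : P [set w | H w - B 0%N w = z] = (\int[P]_w (\1_E (H w, B 0%N w))%:E)%E.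
    transitivity (\int[P]_w (\1_[set w | H w - B 0%N w = z] w)%:E)%E.
      by rewrite integral_indic// setIT.
    apply: eq_integral => w _; rewrite indE indicE; congr ((nat_of_bool _)%:R)%:E.
    by apply/idP/eqP; rewrite inE.
  have mg : measurable_fun setT (fun p : R * R => (\1_E p)%:E : \bar R).
    have mi : measurable_fun setT (\1_E : R * R -> R) by exact: measurable_indic.
    by apply/measurable_EFinP; exact: mi.
  rewrite (ge0_integral_independent2 mH (mB 0) indHB mg)//.
  apply: integral0_eq => w _.
  rewrite -[RHS](exponential_no_atom (H w - z)).
  have mBy : measurable [set v | B 0%N v = H w - z].
    by rewrite -[X in measurable X]setTI; exact: (mB 0 measurableT (measurable_set1 _)).
  transitivity (\int[P]_v (\1_[set v | B 0%N v = H w - z] v)%:E)%E.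
    apply: eq_integral => v _; rewrite indE indicE; congr ((nat_of_bool _)%:R)%:E.
    by apply/eqP/idP; rewrite inE/=; lra.
  by rewrite integral_indic// setIT.
apply/eqP; rewrite -measure_le0 -[X in (_ <= X)%E]N0 le_measure ?inE//.
  rewrite (_ : [set w | _] = [set w | (walk_sup w <= z%:E)%E] `\`
      [set w | (walk_sup w < z%:E)%E]).
    by apply: measurableD; [exact: measurable_walk_sup_le|exact: measurable_walk_sup_lt].
  apply/seteqP; split=> w /=; first by move=> ->; rewrite lexx ltxx.
  move=> [le /negP]; rewrite -leNgt => ge; apply/eqP; rewrite eq_le le.
  exact: ge.
by move=> w /walk_sup_shift.
Qed.

(** The two bounding events differ by the null event that the supremum equals [z]. It covers events
    such as all partial sums lying below [z], whose supremum may still be [z]. *)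
Lemma probability_walk_sup z (S : set Om) : measurable S ->
  [set w | (walk_sup w < z%:E)%E] `<=` S ->
  S `<=` [set w | (walk_sup w <= z%:E)%E] ->
  P S = P [set w | (walk_sup w < z%:E)%E].
Proof.
move=> mS ltS Sle.
have mlt := measurable_walk_sup_lt z.
have mle := measurable_walk_sup_le z.
apply/eqP; rewrite eq_le; apply/andP; split; last by rewrite le_measure ?inE.
apply: (@le_trans _ _ (P [set w | (walk_sup w <= z%:E)%E])).
  by rewrite le_measure ?inE.
have -> : [set w | (walk_sup w <= z%:E)%E] =
    [set w | (walk_sup w < z%:E)%E] `|` [set w | walk_sup w = z%:E].
  apply/seteqP; split=> w /=.
    by rewrite le_eqVlt => /predU1P[]; [right|left].
  by move=> [/ltW|->].
have meq : measurable [set w | walk_sup w = z%:E].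
  rewrite (_ : [set w | _] = [set w | (walk_sup w <= z%:E)%E] `\`
      [set w | (walk_sup w < z%:E)%E]); first exact: measurableD.
  apply/seteqP; split=> w /=; first by move=> ->; rewrite lexx ltxx.
  move=> [le /negP]; rewrite -leNgt => ge; apply/eqP; rewrite eq_le le.
  exact: ge.
have := measureU2 P mlt meq.
by rewrite [X in (_ <= _ + X)%E]walk_sup_no_atom adde0.
Qed.

End walk_supremum.

(** * Regularity and transform of the survival function *)

Section survival_transform.
Context (R : realType) (d : measure_display) (Om : measurableType d)
  (P : probability Om R) (A B : nat -> Om -> R) (mu m : R).
Hypotheses (mA : forall k, measurable_fun setT (A k))
  (mB : forall k, measurable_fun setT (B k))
  (A0 : forall k w, 0 <= A k w) (B0 : forall k w, 0 <= B k w)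
  (indAB : independent_family P (claim_or_gain A B))
  (lawA : forall k (f : R -> \bar R), measurable_fun setT f ->
     (forall x, 0 <= f x)%E -> (\int[P]_w f (A k w) = \int[P]_w f (A 0%N w))%E)
  (lawB : forall k (f : R -> \bar R), measurable_fun setT f ->
     (forall x, 0 <= f x)%E -> (\int[P]_w f (B k w) = \int[P]_w f (B 0%N w))%E)
  (PB : forall t, 0 <= t -> P [set w | t < B 0%N w] = (expR (- (mu * t)))%:E)
  (mu0 : 0 < mu).

Let dl z : R := fine (P [set w | (walk_sup A B w < z%:E)%E]).
Let G z : R := fine (P [set w | (lindley_sup A B 0 w <= z%:E)%E]).
Let Gn n z : R := fine (P [set w | lindley A B n 0 w <= z]).

(** Absence of atoms trades strict for weak inequality. The restriction to [z >= 0] matters: below 0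
    [G] vanishes, while [dl] may not. *)
Let dlG z : 0 <= z -> dl z = G z.
Proof.
move=> z0; rewrite /dl /G; congr fine; apply/esym.
have -> : [set w | (lindley_sup A B 0 w <= z%:E)%E] =
    [set w | (walk_sup A B w <= z%:E)%E].
  by apply/seteqP; split=> w /= /(lindley_sup0_le _ _ _ z0).
apply: (probability_walk_sup mA mB B0 indAB PB) => //.
  exact: measurable_walk_sup_le.
by move=> w /ltW.
Qed.

Let mlindley_sup : measurable_fun setT (lindley_sup A B 0).
Proof.
exact: (measurable_lindley_sup (f := id) (fun i _ => mA i) (fun i _ => mB i)).
Qed.

Let mGnset n z : measurable [set w | lindley A B n 0 w <= z].
Proof.
rewrite (_ : [set w | _] = lindley A B n 0 @^-1` `]-oo, z]).
  by apply: measurable_preimage_itv; exact: mlindley.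
by apply/seteqP; split=> w /=; rewrite in_itv.
Qed.

Let GsetE z : [set w | (lindley_sup A B 0 w <= z%:E)%E] =
  \bigcap_n [set w | lindley A B n 0 w <= z].
Proof.
apply/seteqP; split=> w /=; first by move/lindley_sup_le=> H n _; exact: H.
by move=> H; apply/lindley_sup_le => n; exact: H.
Qed.

Let mGset z : measurable [set w | (lindley_sup A B 0 w <= z%:E)%E].
Proof. by rewrite GsetE; exact: bigcapT_measurable. Qed.

Let fine01 (S : set Om) : measurable S -> 0 <= fine (P S) <= 1.
Proof.
move=> mS; rewrite fine_ge0//=.
by rewrite -lee_fin fineK ?fin_num_measure// probability_le1.
Qed.

Let G_nd : {homo G : x y / x <= y}.
Proof.
move=> x y xy; apply: fine_le; rewrite ?fin_num_measure//.
by rewrite le_measure ?inE// => w /= /le_trans; apply; rewrite lee_fin.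
Qed.

Let Gn_nd n : {homo Gn n : x y / x <= y}.
Proof.
move=> x y xy; apply: fine_le; rewrite ?fin_num_measure//.
by rewrite le_measure ?inE// => w /= /le_trans; exact.
Qed.

Let cvg_Gn z : Gn n z @[n --> \oo] --> G z.
Proof.
apply: fine_cvg; rewrite fineK ?fin_num_measure//.
rewrite GsetE; apply: nonincreasing_cvg_mu => //.
- exact: le_lt_trans (probability_le1 _ _) (ltry _).
- by rewrite -GsetE.
- move=> n k nk; apply/subsetPset => w /=; apply: le_trans.
  exact: lindley_nd.
Qed.

Let mD : measurable (`[0%R, +oo[%classic : set (measurableTypeR R)).
Proof. exact: measurable_itv. Qed.

Let integral_Gn n s : 0 < s ->
  (\int[lebesgue_measure]_(z in `[0%R, +oo[) (expR (- (z * s)) * Gn n z)%:E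
   = (lst P (lindley A B n 0) s / s)%:E)%E.
Proof.
move=> s0; rewrite -integral_expRN_cdf//.
- by apply: eq_integral => z _; rewrite EFinM fineK ?fin_num_measure.
- exact: mlindley.
- by move=> w; exact: lindley_ge0.
Qed.

Lemma integrable_survival s : 0 < s ->
  lebesgue_measure.-integrable `[0, +oo[ (fun z : R => (expR (- (z * s)) * dl z)%:E).
Proof.
move=> s0; have : lebesgue_measure.-integrable `[0, +oo[
    (fun z : R => (expR (- (z * s)) * G z)%:E).
  by apply: integrable_expRN_mul => // z; exact: fine01.
by apply: eq_integrable => // z; rewrite inE/= in_itv/= andbT => z0; rewrite dlG.
Qed.

(** Right-continuity is taken from the distribution function of the real variable
    [fine (lindley_sup A B 0 w)]. *)
Lemma survival_right_continuous z : 0 <= z -> dl x @[x --> z^'+] --> dl z.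
Proof.
move=> z0.
have mY : measurable_fun setT (fun w => fine (lindley_sup A B 0 w)).
  exact: (measurableT_comp (fine_measurable measurableT) mlindley_sup).
pose Y : {RV P >-> R} := mfun_Sub (mem_set mY).
have moo : measurable [set w | lindley_sup A B 0 w = +oo%E].
  rewrite -[X in measurable X]setTI.
  exact: (mlindley_sup measurableT (emeasurable_set1 +oo%E)).
(* [fine] sends [+oo] to 0, so for [x >= 0] the distribution function counts that mass in excess; a
   constant corrects it. *)
pose h x := fine (cdf Y x) - fine (P [set w | lindley_sup A B 0 w = +oo%E]).
have hE x : 0 <= x -> h x = dl x.
  move=> x0; rewrite dlG// /h /G; apply/eqP; rewrite subr_eq; apply/eqP.
  rewrite -fineD ?fin_num_measure// -measureU//; last first.
    by rewrite -subset0 => w /= [+ Sw]; rewrite Sw.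
  congr fine; congr (P _); apply/seteqP; split=> w /=; rewrite in_itv/=.
    case E : (lindley_sup A B 0 w) => [r| |]/=; [by left|by right|].
    by have := lindley_sup_ge0 A B 0 w; rewrite E.
  move=> [|->//]; case E : (lindley_sup A B 0 w) => [r| |]//=.
have hcvg : h x @[x --> z^'+] --> h z.
  apply: cvgB; last exact: cvg_cst.
  apply: fine_cvg; rewrite fineK ?fin_num_measure//.
  exact: cdf_right_continuous.
rewrite -hE//; apply: cvg_trans hcvg; apply: near_eq_cvg.
near=> x; apply: hE; rewrite (le_trans z0)//.
Unshelve. all: by end_near. Qed.

Lemma laplace_class_survival : laplace_class dl.
Proof.
by split; [exact: integrable_survival|exact: survival_right_continuous].
Qed.

Hypotheses (EA : (\int[P]_w (A 0%N w)%:E = m%:E)%E)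
  (Apos : {ae P, forall w, 0 < A 0%N w}) (load : mu * m <= 1).

(** The finite-horizon distribution functions have transform [psi_n(s) / s] and decrease to [G];
    dominated convergence passes to the limit. *)
Lemma laplace_survival s : 0 < s ->
  laplace dl s = (1 - mu * m) / (s - mu * (1 - lst P (A 0%N) s)).
Proof.
move=> s0.
have -> : laplace dl s = \int[lebesgue_measure]_(z in `[0, +oo[) (expR (- (z * s)) * G z).
  by apply: eq_Rintegral => z; rewrite inE/= in_itv/= andbT => z0; rewrite dlG.
have iGn n := integrable_expRN_mul s0 (@Gn_nd n) (fun z => fine01 (mGnset n z)).
have iG := integrable_expRN_mul s0 G_nd (fun z => fine01 (mGset z)).
have f_cvg : {ae lebesgue_measure, forall z, (`[0, +oo[%classic : set R) z ->
    (expR (- (z * s)) * Gn n z)%:E @[n --> \oo] --> (expR (- (z * s)) * G z)%:E}.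
  apply: aeW => z _; apply: cvg_EFin; first exact: nearW.
  by apply: cvgMr; exact: cvg_Gn.
have f_le : {ae lebesgue_measure, forall z n, (`[0, +oo[%classic : set R) z ->
    (`|(expR (- (z * s)) * Gn n z)%:E| <= (expR (- (z * s)))%:E)%E}.
  apply: aeW => z n _; have /andP[f0 f1] := fine01 (mGnset n z).
  by rewrite lee_fin normrM !ger0_norm ?expR_ge0// ler_piMr ?expR_ge0.
have [_ _] := dominated_convergence mD (fun n => measurable_int lebesgue_measure (iGn n))
  (measurable_int lebesgue_measure iG) f_cvg (integrable_expRN_itvy s0) f_le.
under eq_fun do rewrite integral_Gn//.
move=> lim.
have lim2 : (lst P (lindley A B n 0) s / s)%:E @[n --> \oo] -->
    (s * (1 - mu * m) / (s - mu * (1 - lst P (A 0%N) s)) / s)%:E.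
  apply: cvg_EFin; first exact: nearW.
  apply: cvgMl.
  exact: (cvg_lst_lindley mA mB A0 B0 indAB lawA lawB PB mu0 EA Apos load s0).
rewrite /Rintegral (cvg_unique _ lim lim2)//=.
by rewrite mulrC !mulrA mulVf ?mul1r// gt_eqF.
Qed.

End survival_transform.

(** * The risk model *)

Section product_rule.
Context (R : realType) (d : measure_display) (Om : measurableType d)
  (P : probability Om R).

Lemma sigma_of_setT (I : Type) (D : set I) (d' : measure_display)
    (E : measurableType d') (X : I -> Om -> E) : sigma_of D X setT.
Proof. exact: (@measurableT _ (g_sigma_algebraType _)). Qed.

Lemma sigma_of_bigcap (X : nat -> Om -> R) (J : seq nat) (S : nat -> set R) :
  (forall j, measurable (S j)) ->
  sigma_of setT X (\big[setI/setT]_(j <- J) (X j @^-1` S j)).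
Proof.
move=> mS; apply: (big_ind (sigma_of setT X)).
- exact: sigma_of_setT.
- exact: (@measurableI _ (g_sigma_algebraType _)).
- move=> j _; apply: sub_sigma_algebra; exists j => //.
  by exists (S j) => //; rewrite setTI.
Qed.

(** Split the index list by its tag: the triple rule, with the whole space as third event, separates
    claims from gains, and each family then has its own product rule. *)
Lemma independent_claim_or_gain (U V : nat -> {RV P >-> R}) (f g : R -> R)
    (S3 : set (set Om)) :
  measurable_fun setT f -> measurable_fun setT g ->
  mutually_independent U -> mutually_independent V ->
  independent3 P (sigma_of setT (fun k : nat => U k : Om -> R))
    (sigma_of setT (fun k : nat => V k : Om -> R)) S3 -> S3 setT ->
  independent_family P (claim_or_gain (fun k w => f (U k w)) (fun k w => g (V k w))).
Proof.
move=> mf mg indU indV ind3 S3T J S uJ mS.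
pose SU k := f @^-1` S (false, k); pose SV k := g @^-1` S (true, k).
have mSU k : measurable (SU k) by rewrite -[X in measurable X]setTI; exact: mf.
have mSV k : measurable (SV k) by rewrite -[X in measurable X]setTI; exact: mg.
pose JU := [seq i.2 | i <- J & ~~ i.1]; pose JV := [seq i.2 | i <- J & i.1].
have uU : uniq JU.
  rewrite map_inj_in_uniq ?filter_uniq// => -[b1 k1] [b2 k2].
  by rewrite !mem_filter /= => /andP[/negbTE -> _] /andP[/negbTE -> _] ->.
have uV : uniq JV.
  rewrite map_inj_in_uniq ?filter_uniq// => -[b1 k1] [b2 k2].
  by rewrite !mem_filter /= => /andP[-> _] /andP[-> _] ->.
pose Z := claim_or_gain (fun k w => f (U k w)) (fun k w => g (V k w)).
rewrite -/Z (bigID (fun i => ~~ i.1)) [in RHS](bigID (fun i => ~~ i.1)) /=.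
have capU : \big[setI/setT]_(i <- J | ~~ i.1) (Z i @^-1` S i) =
    \big[setI/setT]_(k <- JU) (U k @^-1` SU k).
  by rewrite big_map big_filter; apply: eq_bigr => -[[] k].
have capV : \big[setI/setT]_(i <- J | ~~ ~~ i.1) (Z i @^-1` S i) =
    \big[setI/setT]_(k <- JV) (V k @^-1` SV k).
  rewrite big_map big_filter; apply: eq_big => [[b k]|[[] k]]//=.
  by rewrite negbK.
rewrite capU capV -[X in P X]setIT ind3//; last 2 first.
- exact: sigma_of_bigcap.
- exact: sigma_of_bigcap.
rewrite probability_setT mule1 indU// indV//; congr (_ * _)%E.
  by rewrite big_map big_filter; apply: eq_bigr => -[[] k].
rewrite big_map big_filter; apply: eq_big => [[b k]|[[] k]]//=.
by rewrite negbK.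
Qed.

Lemma identically_distributed_integral (U : nat -> {RV P >-> R}) k (h : R -> \bar R) :
  identically_distributed U -> measurable_fun setT h -> (forall x, 0 <= h x)%E ->
  (\int[P]_w h (U k w) = \int[P]_w h (U 0%N w))%E.
Proof.
move=> idU mh h0.
transitivity (\int[distribution P (U k)]_x h x)%E.
  by rewrite ge0_integral_distribution.
transitivity (\int[distribution P (U 0%N)]_x h x)%E.
  by apply: eq_measure_integral => S mS _; exact: idU.
by rewrite ge0_integral_distribution.
Qed.

End product_rule.

(** * Weibull variables and the exponential law of the gains *)

Section weibull.
Context (R : realType) (d : measure_display) (Om : measurableType d)
  (P : probability Om R) (alpha beta gamma : R) (V : {RV P >-> R}).
Hypotheses (alpha0 : 0 < alpha) (beta0 : 0 < beta) (gamma0 : 0 < gamma)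
  (Vcdf : forall x : R, 0 < x ->
     cdf V x = (1 - expR (- (gamma * x `^ alpha)))%:E).

(** The distribution function is prescribed for [x > 0]; its value at 0 follows by monotonicity as
    [x] decreases to 0. *)
Lemma weibull_le0 : P [set w | V w <= 0] = 0%E.
Proof.
have V0 : P [set w | V w <= 0] = cdf V 0.
  by congr (P _); apply/seteqP; split=> w /=; rewrite in_itv.
rewrite V0; apply/eqP; rewrite eq_le cdf_ge0 andbT.
apply/lee_addgt0Pr => e e0; rewrite add0e.
(* Chosen so that [gamma * x ^ alpha = e], whence the mass is at most [1 - exp (- e) <= e]. *)
pose x := (e / gamma) `^ alpha^-1.
have eg0 : 0 < e / gamma by rewrite divr_gt0.
have x0 : 0 < x by rewrite powR_gt0.
apply: (le_trans (cdf_nondecreasing V (ltW x0))).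
rewrite Vcdf// lee_fin -powRrM mulVf ?gt_eqF// powRr1 ?ltW//.
rewrite mulrC divfK ?gt_eqF//.
have := @expR_gt1Dx R (- e); rewrite oppr_eq0 gt_eqF// => /(_ isT); lra.
Qed.

(** On [V > 0] the event is [V > x] with [beta^alpha x^alpha = t]. The two can differ on [V <= 0],
    where [powR] may take its default value, but that event is null. *)
Lemma weibull_gain_tail t : 0 <= t ->
  P [set w | t < beta `^ alpha * V w `^ alpha] =
  (expR (- (gamma / beta `^ alpha * t)))%:E.
Proof.
move=> t0; have b0 : 0 < beta `^ alpha by rewrite powR_gt0.
pose x := (t / beta `^ alpha) `^ alpha^-1.
have x0 : 0 <= x by exact: powR_ge0.
have xa : x `^ alpha = t / beta `^ alpha.
  by rewrite /x -powRrM mulVf ?gt_eqF// powRr1// divr_ge0 // ltW.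
have mneg : measurable [set w | V w <= 0].
  rewrite (_ : [set w | _] = V @^-1` `]-oo, 0]); first exact: measurable_funPTI.
  by apply/seteqP; split=> w /=; rewrite in_itv.
have mgt : measurable [set w | x < V w].
  rewrite (_ : [set w | _] = V @^-1` `]x, +oo[); first exact: measurable_funPTI.
  by apply/seteqP; split=> w /=; rewrite in_itv/= andbT.
have mtail : measurable [set w | t < beta `^ alpha * V w `^ alpha].
  rewrite (_ : [set w | _] =
    (fun w => beta `^ alpha * V w `^ alpha) @^-1` `]t, +oo[).
    apply: measurable_preimage_itv; apply: measurable_funM => //.
    exact: (measurableT_comp (measurable_powR alpha)).
  by apply/seteqP; split=> w /=; rewrite in_itv/= andbT.
have Pgt : P [set w | x < V w] = (expR (- (gamma / beta `^ alpha * t)))%:E.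
  have c : cdf V x = (1 - expR (- (gamma * x `^ alpha)))%:E.
    move: x0; rewrite le_eqVlt => /predU1P[<-|/Vcdf//].
    rewrite powR0 ?gt_eqF// mulr0 oppr0 expR0 subrr.
    transitivity (P [set w | V w <= 0]); last exact: weibull_le0.
    by congr (P _); apply/seteqP; split=> w /=; rewrite in_itv.
  have := cdf_ccdf_1 V x; rewrite c xa.
  rewrite (_ : ccdf V x = P [set w | x < V w]); last first.
    by congr (P _); apply/seteqP; split=> w /=; rewrite in_itv/= andbT.
  rewrite -[P _]fineK ?fin_num_measure// -EFinD => -[] e; congr EFin.
  by rewrite [gamma / _ * t]mulrAC -mulrA; lra.
rewrite -Pgt; apply/eqP; rewrite eq_le; apply/andP; split.
  apply: (@le_trans _ _ (P ([set w | x < V w] `|` [set w | V w <= 0]))).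
    rewrite le_measure ?inE//; first exact: measurableU.
    move=> w /=; rewrite mulrC -ltr_pdivrMr// -xa => xV.
    have [V0|V0] := leP (V w) 0; [by right|left].
    rewrite ltNge; apply/negP => Vx; move: xV; rewrite ltNge => /negP; apply.
    by apply: (ge0_ler_powR (ltW alpha0)) => //; rewrite ?nnegrE ?ltW.
  by have := measureU2 P mgt mneg; rewrite [X in (_ <= _ + X)%E]weibull_le0 adde0.
rewrite le_measure ?inE// => w /= xV; rewrite mulrC -ltr_pdivrMr// -xa.
by apply: (gt0_ltr_powR alpha0) => //; rewrite ?nnegrE// (le_trans x0) ?ltW.
Qed.

End weibull.

Lemma limn_series_single (R : realType) (f : nat -> R) (n0 : nat) : (1 <= n0)%N ->
  (forall n, n != n0 -> f n = 0) -> \big[+%R/0]_(1 <= n <oo) f n = f n0.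
Proof.
move=> n01 f0; apply: cvg_lim => //.
apply: cvg_near_cst; exists n0.+1 => // k /= n0k.
rewrite (bigD1_seq n0) ?iota_uniq ?mem_index_iota ?n01//=.
by rewrite big1 ?addr0// => i /f0.
Qed.

(** * Arrival counts and the times that realise them *)

Section arrivals.
Context (R : realType) (Om : Type) (T : nat -> Om -> R).

Lemma arrival_countP t w n : (1 <= n)%N ->
  arrival_count T t w = (n%:R : R)%:E <->
  \sum_(k < n) T k w < t /\ forall j, (n < j)%N -> t <= \sum_(k < j) T k w.
Proof.
move=> n1; rewrite /arrival_count; set S := [set n | _].
case: asboolP => S0.
  split=> [/esym/eqP|[nt _]].
    by rewrite eqe pnatr_eq0 => /eqP n0; rewrite n0 in n1.
  have : S n by split.
  by rewrite S0.
split=> [E|[nt Hj]].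
  have ub j : S j -> (j <= n)%N.
    move=> Sj; rewrite -(ler_nat R) -lee_fin -E.
    by apply: ereal_sup_ubound; exists j.
  (* A supremum of integers equal to [n] is attained: otherwise every member would be at most
     [n - 1]. *)
  have Sn : S n.
    apply: contrapT => nSn.
    have : (ereal_sup [set (j%:R : R)%:E | j in S] <= (n.-1%:R : R)%:E)%E.
      apply: ge_ereal_sup => _ [j Sj <-]; rewrite lee_fin ler_nat.
      have := ub j Sj; rewrite leq_eqVlt => /predU1P[jn|].
        by exfalso; apply: nSn; rewrite -jn.
      by case: (n) n1.
    by rewrite E lee_fin ler_nat leqNgt prednK ?leqnn.
  split; first by case: Sn.
  move=> j nj; rewrite leNgt; apply/negP => jt.
  have /ub : S j by split=> //; exact: leq_ltn_trans nj.
  by rewrite leqNgt nj.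
apply/eqP; rewrite eq_le; apply/andP; split; last first.
  by apply: ereal_sup_ubound; exists n.
apply: ge_ereal_sup => _ [j [j1 jt] <-]; rewrite lee_fin ler_nat leqNgt.
by apply/negP => /Hj; rewrite leNgt jt.
Qed.

Lemma arrival_count_hits w n : (1 <= n)%N -> (forall k, 0 < T k w) ->
  exists2 t, 0 < t & arrival_count T t w = (n%:R : R)%:E.
Proof.
move=> n1 T0.
have nd : {homo (fun n => \sum_(k < n) T k w) : i j / (i <= j)%N >-> i <= j}.
  apply: homo_leq => //; first by move=> ? ? ?; exact: le_trans.
  by move=> i; rewrite big_ord_recr/= lerDl ltW.
(* The count uses [S_k < t], so at [t = S_(n+1)] the arrival [n + 1] is not yet counted. *)
exists (\sum_(k < n.+1) T k w).
  rewrite big_ord_recr/= ltr_wpDl// sumr_ge0// => k _; exact: ltW.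
apply/arrival_countP => //; split; first by rewrite big_ord_recr/= ltrDl.
by move=> j nj; exact: nd.
Qed.

End arrivals.

Section risk.
Context (R : realType) (Om : Type) (alpha beta u : R) (U V : nat -> Om -> R)
  (N : R -> Om -> \bar R).
Hypotheses (alpha0 : 0 < alpha) (beta0 : 0 < beta) (u0 : 0 < u).

Lemma power_sum_powR (Z : nat -> Om -> R) n w :
  power_sum alpha Z n w `^ alpha = \sum_(k < n) Z k w `^ alpha.
Proof.
by rewrite /power_sum -powRrM mulVf ?gt_eqF// powRr1// sumr_ge0// => k _; exact: powR_ge0.
Qed.

(** Each series reduces to its term [n], and the two powers [1 / alpha] are compared through strict
    monotonicity on nonnegative reals. *)
Lemma risk_process_le0 t w n : (1 <= n)%N -> N t w = (n%:R : R)%:E ->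
  (risk_process alpha beta u U V N t w <= 0) =
  (u `^ alpha <= \sum_(i < n) (U i w `^ alpha - beta `^ alpha * V i w `^ alpha)).
Proof.
move=> n1 Nn.
have ind k : \1_[set w' | N t w' = (k%:R : R)%:E] w = (k == n)%:R :> R.
  rewrite indicE; congr (nat_of_bool _)%:R; apply/idP/eqP; rewrite inE/= Nn.
    by move=> [/eqP]; rewrite eqr_nat => /eqP.
  by move=> ->.
have ser (Z : nat -> Om -> R) : \big[+%R/0]_(1 <= k <oo) (power_sum alpha Z k w `^ alpha *
    \1_[set w' | N t w' = (k%:R : R)%:E] w) = \sum_(k < n) Z k w `^ alpha.
  rewrite (@limn_series_single _ _ n)//; first by rewrite ind eqxx mulr1 power_sum_powR.
  by move=> k kn; rewrite ind (negbTE kn) mulr0.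
rewrite /risk_process.
set a := (X in _ + _ * X); set b := (X in _ - X `^ _).
rewrite (ser V : a = _) (ser U : b = _) subr_le0.
have ge0 (Z : nat -> Om -> R) : 0 <= \sum_(k < n) Z k w `^ alpha.
  by rewrite sumr_ge0// => k _; exact: powR_ge0.
have b0 : 0 <= beta `^ alpha * \sum_(k < n) V k w `^ alpha.
  by rewrite mulr_ge0// powR_ge0.
rewrite sumrB -mulr_sumr lerBrDr.
have ia : 0 < alpha^-1 by rewrite invr_gt0.
apply/idP/idP => [|le]; last first.
  by apply: (ge0_ler_powR (ltW ia)) => //; rewrite nnegrE// addr_ge0// powR_ge0.
apply: contraTT; rewrite -!ltNge => lt.
by apply: (gt0_ltr_powR ia) => //; rewrite nnegrE// addr_ge0// powR_ge0.
Qed.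

(** This covers a zero count as well as an infinite one: both series vanish, the process equals its
    initial capital, and no ruin occurs at such a time. *)
Lemma risk_process_no_arrival t w : (forall n, (1 <= n)%N -> N t w <> (n%:R : R)%:E) ->
  risk_process alpha beta u U V N t w = u.
Proof.
move=> Nn.
have ser (Z : nat -> Om -> R) : \big[+%R/0]_(1 <= k <oo) (power_sum alpha Z k w `^ alpha *
    \1_[set w' | N t w' = (k%:R : R)%:E] w) = 0.
  apply: cvg_lim => //; apply: cvg_near_cst; apply: nearW => k.
  rewrite big_nat big1// => i /andP[i1 _].
  by rewrite indicE memNset ?mulr0//=; exact: Nn.
rewrite /risk_process.
set a := (X in _ + _ * X); set b := (X in _ - X `^ _).
rewrite (ser V : a = _) (ser U : b = _) mulr0 addr0 powR0 ?invr_eq0 ?gt_eqF// subr0.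
by rewrite -powRrM mulfV ?gt_eqF// powRr1// ltW.
Qed.

End risk.

Lemma exponential_prob_le0 (R : realType) (lambda : R) :
  exponential_prob lambda `]-oo, 0] = 0%E.
Proof.
rewrite /exponential_prob -integral_itv_bndo_bndc.
  apply: integral0_eq => x /=; rewrite in_itv/= => x0.
  by rewrite lt0_exponential_pdf.
apply/measurable_EFinP; apply: measurable_funTS.
exact: measurable_exponential_pdf.
Qed.

(** * The ruin event as a level crossing of the walk *)

Section ruin_event.
Context (R : realType) (d : measure_display) (Om : measurableType d)
  (P : probability Om R) (T : nat -> Om -> R).
Hypothesis mT : forall k, measurable_fun setT (T k).

(** The times with count [n] form an interval open on the left, so a witness can be lowered to a
    rational one and the event is a countable union. *)
Lemma measurable_arrival_hits n : (1 <= n)%N ->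
  measurable [set w | exists2 t, 0 < t & arrival_count T t w = (n%:R : R)%:E].
Proof.
move=> n1.
have mS k : measurable_fun setT (fun w => \sum_(i < k) T i w).
  by apply: measurable_sum => i.
pose H (q : rat) := [set w | 0 < ratr q :> R] `&`
  ([set w | \sum_(i < n) T i w < ratr q] `&`
   \bigcap_j [set w | (n < j)%N -> ratr q <= \sum_(i < j) T i w]).
rewrite (_ : [set w | _] = \bigcup_q H q).
  apply: bigcupT_measurable_rat => q; apply: measurableI.
    by case: (0 < ratr q :> R); rewrite ?set_true ?set_false.
  apply: measurableI.
    rewrite (_ : [set w | _] = (fun w => \sum_(i < n) T i w) @^-1` `]-oo, ratr q[).
      exact: measurable_preimage_itv.
    by apply/seteqP; split=> w /=; rewrite in_itv.
  apply: bigcapT_measurable => j.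
  have [nj|nj] := ltnP n j.
    rewrite (_ : [set w | _] = (fun w => \sum_(i < j) T i w) @^-1` `[ratr q, +oo[).
      exact: measurable_preimage_itv.
    apply/seteqP; split=> w /=; rewrite in_itv/= andbT; first exact.
    by [].
  rewrite (_ : [set w | _] = setT)//.
  by apply/seteqP; split.
apply/seteqP; split=> w /=.
  move=> [t t0 /arrival_countP -/(_ n1)[nt Hj]].
  have maxt : Num.max 0 (\sum_(i < n) T i w) < t by rewrite gt_max t0.
  have [q] := rat_in_itvoo maxt.
  rewrite in_itv/= gt_max => /andP[/andP[q0 qn] qt].
  exists q => //; split=> //; split=> // j _ /Hj; exact: le_trans (ltW qt).
move=> [q _ [q0 [nq Hj]]]; exists (ratr q) => //.
by apply/arrival_countP => //; split=> // j; exact: Hj.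
Qed.

(** Ruin always entails a crossing by the walk. Conversely, a crossing at [n] causes ruin once the
    count [n] occurs, which holds whenever all interarrival times are positive. *)
Lemma ruin_probability_walk (alpha beta u : R) (U V : nat -> Om -> R) :
  0 < alpha -> 0 < beta -> 0 < u ->
  (forall k, measurable_fun setT (U k)) -> (forall k, measurable_fun setT (V k)) ->
  {ae P, forall w k, 0 < T k w} ->
  ruin_probability P (risk_process alpha beta u U V (arrival_count T)) =
  P [set w | exists2 n, (1 <= n)%N &
     u `^ alpha <= \sum_(i < n) (U i w `^ alpha - beta `^ alpha * V i w `^ alpha)].
Proof.
move=> alpha0 beta0 u0 mU mV Tpos.
pose W n w := \sum_(i < n) (U i w `^ alpha - beta `^ alpha * V i w `^ alpha).
pose hits n := [set w | exists2 t, 0 < t & arrival_count T t w = (n%:R : R)%:E].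
have mW n : measurable [set w | u `^ alpha <= W n w].
  rewrite (_ : [set w | _] = W n @^-1` `[u `^ alpha, +oo[).
    apply: measurable_preimage_itv; apply: measurable_sum => i.
    apply: measurable_funB; last apply: measurable_funM => //.
      exact: (measurableT_comp (measurable_powR alpha)).
    exact: (measurableT_comp (measurable_powR alpha)).
  by apply/seteqP; split=> w /=; rewrite in_itv/= andbT.
rewrite /ruin_probability.
set E := [set w | _]; set E' := [set w | _].
(* This replaces the uncountable union over times by a countable one over counts, whence
   measurability. *)
have EE : E = \bigcup_n (hits n.+1 `&` [set w | u `^ alpha <= W n.+1 w]).
  apply/seteqP; split=> w.
    move=> [t [t0 Rt]].
    have [[n n1 Nn]|noN] := pselect (exists2 n, (1 <= n)%N &
        arrival_count T t w = (n%:R : R)%:E).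
      case: n n1 Nn => // n _ Nn; exists n => //; split; first by exists t.
      by move: Rt; rewrite (risk_process_le0 _ _ _ _ alpha0 _ Nn).
    move: Rt; rewrite risk_process_no_arrival//; first by rewrite leNgt u0.
    by move=> n n1 Nn; apply: noN; exists n.
  move=> [n _ [[t t0 Nn] le]]; exists t; split => //.
  by rewrite (risk_process_le0 _ _ _ _ alpha0 _ Nn).
have EE' : E' = \bigcup_n [set w | u `^ alpha <= W n.+1 w].
  apply/seteqP; split=> w; first by move=> [[//|n] _ le]; exists n.
  by move=> [n _ le]; exists n.+1.
have mE : measurable E.
  rewrite EE; apply: bigcupT_measurable => n; apply: measurableI => //.
  exact: measurable_arrival_hits.
have mE' : measurable E' by rewrite EE'; exact: bigcupT_measurable.
have sub : E `<=` E' by rewrite EE EE' => w [n _ [_ le]]; exists n.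
case: Tpos => N [mN N0 subN].
apply/eqP; rewrite eq_le; apply/andP; split; first by rewrite le_measure ?inE.
apply: (@le_trans _ _ (P (E `|` N))).
  rewrite le_measure ?inE//; first exact: measurableU.
  move=> w E'w; have [Tw|nTw] := pselect (forall k, 0 < T k w); last first.
    by right; apply: subN.
  left; rewrite EE; move: E'w; rewrite EE' => -[n _ le]; exists n => //; split=> //.
  exact: arrival_count_hits.
by have := measureU2 P mE mN; rewrite [X in (_ <= _ + X)%E]N0 adde0.
Qed.

End ruin_event.

Theorem mainTheorem1 (R : realType) (d : measure_display)
    (Om : measurableType d) (P : probability Om R)
    (alpha beta gamma lambda u : R)
    (halpha : 0 < alpha) (hbeta : 0 < beta) (hgamma : 0 < gamma)
    (hlambda : 0 < lambda) (hu : 0 < u)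
    (U V T : nat -> {RV P >-> R})
    (hUiid : iid U)
    (hUpos : forall k : nat, {ae P, forall w : Om, 0 < U k w})
    (m : R) (hm : ('E_P[fun w : Om => (U 0%N w `^ alpha)%R] = m%:E)%E)
    (F : R -> R)
    (hF : forall x : R, P [set w | U 0%N w `^ alpha <= x] = (F x)%:E)
    (hViid : iid V)
    (hVcdf : forall (k : nat) (x : R), 0 < x ->
       cdf (V k) x = (1 - expR (- (gamma * x `^ alpha)))%:E)
    (hTiid : iid T)
    (hTexp : forall (k : nat) (A : set R), measurable A ->
       distribution P (T k) A = exponential_prob lambda A)
    (hindep : independent3 P
       (sigma_of setT (fun k : nat => U k))
       (sigma_of setT (fun k : nat => V k))
       (sigma_of [set t : R | 0 <= t]
          (arrival_count (fun k : nat => T k)))) :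
  let N := arrival_count (fun k : nat => T k) in
  let delta := survival P alpha beta (fun k : nat => U k) (fun k : nat => V k) in
  let Fbar := fun x : R => 1 - F x in
  let deltahat := fun s : R =>
    (beta `^ alpha - gamma * m) /
    ((beta `^ alpha - gamma * laplace Fbar s) * s) in
  ruin_probability P
    (risk_process alpha beta u (fun k : nat => U k) (fun k : nat => V k) N)
    = (1 - delta (u `^ alpha))%:E
  /\
  (gamma * m <= beta `^ alpha ->
    [/\ laplace_class delta,
        forall s : R, 0 < s -> laplace delta s = deltahat s
      & forall g : R -> R, laplace_class g ->
          (forall s : R, 0 < s -> laplace g s = deltahat s) ->
          forall z : R, 0 <= z -> g z = delta z]).
Proof.
move=> N delta Fbar deltahat.
have b0 : 0 < beta `^ alpha by rewrite powR_gt0.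
pose A k w := U k w `^ alpha.
pose B k w := beta `^ alpha * V k w `^ alpha.
pose mu := gamma / beta `^ alpha.
have mu0 : 0 < mu by rewrite divr_gt0.
pose g (x : R) := beta `^ alpha * x `^ alpha.
have mg : measurable_fun setT g.
  by apply: measurable_funM => //; exact: measurable_powR.
have mpow : measurable_fun setT (fun x : R => x `^ alpha) by exact: measurable_powR.
have mA k : measurable_fun setT (A k) by exact: (measurableT_comp mpow).
have mB k : measurable_fun setT (B k) by exact: (measurableT_comp mg).
have A0 k w : 0 <= A k w by exact: powR_ge0.
have B0 k w : 0 <= B k w by rewrite mulr_ge0// powR_ge0.
have indAB : independent_family P (claim_or_gain A B).
  have [indU _] := hUiid; have [indV _] := hViid.
  apply: (independent_claim_or_gain mpow mg indU indV hindep).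
  exact: sigma_of_setT.
have lawA k (f : R -> \bar R) : measurable_fun setT f -> (forall x, 0 <= f x)%E ->
    (\int[P]_w f (A k w) = \int[P]_w f (A 0%N w))%E.
  move=> mf f0; have [_ idU] := hUiid.
  exact: (identically_distributed_integral k idU (measurableT_comp mf mpow)
    (fun x => f0 _)).
have lawB k (f : R -> \bar R) : measurable_fun setT f -> (forall x, 0 <= f x)%E ->
    (\int[P]_w f (B k w) = \int[P]_w f (B 0%N w))%E.
  move=> mf f0; have [_ idV] := hViid.
  exact: (identically_distributed_integral k idV (measurableT_comp mf mg)
    (fun x => f0 _)).
have PB t : 0 <= t -> P [set w | t < B 0%N w] = (expR (- (mu * t)))%:E.
  exact: (weibull_gain_tail halpha hbeta hgamma (hVcdf 0%N)).
have EA : (\int[P]_w (A 0%N w)%:E = m%:E)%E by rewrite -hm unlock.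
have Apos : {ae P, forall w, 0 < A 0%N w}.
  by apply: filterS (hUpos 0%N) => w; exact: powR_gt0.
have Tpos : {ae P, forall w k, 0 < T k w}.
  apply: ae_foralln => k; exists [set w | T k w <= 0]; split => //.
  - rewrite (_ : [set w | _] = T k @^-1` `]-oo, 0]); first exact: measurable_funPTI.
    by apply/seteqP; split=> w /=; rewrite in_itv.
  - have := hTexp k _ (measurable_itv `]-oo, 0]).
    rewrite exponential_prob_le0 => <-.
    by congr (P _); apply/seteqP; split=> w /=; rewrite in_itv.
  - by move=> w /= /negP; rewrite -leNgt.
split.
  rewrite ruin_probability_walk//.
  set z := u `^ alpha; set E' := [set w | _].
  (* Survival keeps every partial sum below [z], an event between [sup < z] and [sup <= z];
     [probability_walk_sup] identifies its probability. *)
  have E'C : E' = ~` [set w | forall n, (1 <= n)%N -> walk A B n w < z].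
    apply/seteqP; split=> w /=.
      by move=> [n n1 le] /(_ n n1); rewrite ltNge => /negP; exact.
    move=> nlt; apply: contrapT => nE; apply: nlt => n n1; rewrite ltNge.
    by apply/negP => le; apply: nE; exists n.
  have mlt : measurable [set w | forall n, (1 <= n)%N -> walk A B n w < z].
    rewrite (_ : [set w | _] = \bigcap_n (walk A B n.+1 @^-1` `]-oo, z[)).
      apply: bigcapT_measurable => n; apply: measurable_preimage_itv.
      exact: (measurable_walk mA mB).
    apply/seteqP; split=> w /=.
      by move=> H n _; rewrite /= in_itv/=; exact: H.
    by move=> H [//|n] _; have := H n I; rewrite /= in_itv.
  rewrite E'C probability_setC// (probability_walk_sup mA mB B0 indAB PB (z := z))//.
  - by rewrite EFinB /delta /survival fineK ?fin_num_measure//;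
      exact: (measurable_walk_sup_lt mA mB).
  - move=> w /= /walk_sup_lt [k H] n n1; apply: le_lt_trans (H n n1) _.
    by rewrite ltrBlDr ltrDl invr_gt0.
  - by move=> w /= H; apply/walk_sup_le => n n1; exact/ltW/H.
move=> load0.
have load : mu * m <= 1 by rewrite /mu mulrAC ler_pdivrMr// mul1r.
have ldelta s : 0 < s -> laplace delta s = deltahat s.
  move=> s0.
  have := laplace_survival mA mB A0 B0 indAB lawA lawB PB mu0 EA Apos load s0.
  have := lindley_transform_gt0 mA A0 mu0 EA Apos load s0.
  have -> : laplace delta s =
    laplace (fun z => fine (P [set w | (walk_sup A B w < z%:E)%E])) s by [].
  move=> D0 ->; rewrite /deltahat (laplace_ccdf (mA 0%N) (A0 0%N) hF s0).
  move: D0; rewrite /mu; set l := lst _ _ _; set b := beta `^ alpha in b0 * => D0.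
  have bn0 : b != 0 by rewrite gt_eqF.
  have sn0 : s != 0 by rewrite gt_eqF.
  have Dn0 := lt0r_neq0 D0.
  (* This is [b] times the positive denominator of the limit formula; it appears once [deltahat] is
     cleared of fractions. *)
  have Db : b * s - gamma * (1 - l) != 0.
    rewrite (_ : _ - _ = b * (s - gamma / b * (1 - l))) ?mulf_neq0//.
    by field.
  by field; rewrite bn0 sn0 Db.
have lclass : laplace_class delta.
  exact: (laplace_class_survival mA mB B0 indAB PB).
split=> // h hclass hl z z0.
apply: (laplace_class_inj hclass lclass) => // s s0.
by rewrite hl// ldelta.
Qed.
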